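(* Let $U\subset\mathbb{R}^2$ be a domain and let $\rho$ be any linear injection from $U$ into $\mathcal{S}_2$ such that $\rho(U)\subset\mathcal{S}_2^+$. Let $\mathscr{P}_2^\rho$ be the statistical model induced by $\rho$, $g_\rho$ its Fisher metric, $D$ its standard flat connection, and $D^*$ the dual connection of $D$ with respect to $g_\rho$. Then $(\mathscr{P}_2^\rho,g_\rho,D^* )$ is Hesse-Einstein. Hence $(T\mathscr{P}_2^\rho,J^{D^*},\widetilde{g_\rho}^{D^*})$ is a Kähler-Einstein manifold.
   Context: $\mathcal{S}_2$ is the space of real symmetric $2\times2$ matrices, $\mathcal{S}_2^+\subset\mathcal{S}_2$ the positive definite ones. A linear injection $\rho:U\to\mathcal{S}_2$ is the restriction to $U$ of an injective linear map $\mathbb{R}^2\to\mathcal{S}_2$. Statistical model: for $(\mu,\xi)\in\mathbb{R}^2\times U$ let $$p(x;\mu,\xi)=\sqrt{\frac{\det\rho(\xi)}{(2\pi)^2}}\exp\left\{-\tfrac12\,{}^t(x-\mu)\rho(\xi)(x-\mu)\right\},\quad x\in\mathbb{R}^2,$$ and $\mathscr{P}_2^\rho=\{p(\cdot;\mu,\xi)\mid(\mu,\xi)\in\mathbb{R}^2\times U\}$, a smooth 4-dimensional manifold parametrized by $(\mu,\xi)$. With $\theta=\rho(\xi)\mu$, the pair $(\theta,\xi)\in\mathbb{R}^2\times U$ gives global coordinates, and $D$ is the standard flat connection for which $(\theta,\xi)$ are affine coordinates. The Fisher metric $g_\rho$ is the Hessian metric $g_\rho=Dd\varphi$ with potential $$\varphi(\theta,\xi)=\tfrac12\left\{{}^t\theta\,\rho(\xi)^{-1}\theta-\log\det\rho(\xi)\right\}.$$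 Dual connection: $Z(g(X,Y))=g(D^*_ZX,Y)+g(X,D_ZY)$ for all vector fields $X,Y,Z$. A triple $(M,g,D)$ is a Hessian manifold if $D$ and its dual connection with respect to $g$ are both flat (vanishing torsion and curvature). For a Hessian manifold $(M,g,D)$, the first Koszul form is the 1-form $\alpha(X)=g(D_Xdv_g,dv_g)$, where $dv_g$ is the volume form of $g$ (and $g$ denotes the induced inner product on top-degree forms, so that $dv_g$ has norm 1), and the second Koszul form is $\beta=D\alpha$. $(M,g,D)$ is Hesse-Einstein if $\beta$ is proportional to $g$. (Here these notions are applied to the connection $D^*$ and metric $g_\rho$.) For a metric $g$ and affine connection $\mathcal{D}$ on $M$ with coefficients $\mathcal{D}_{\partial/\partial x^i}\frac{\partial}{\partial x^j}=\sum_k\Gamma^k_{ij}\frac{\partial}{\partial x^k}$, use on $TM$ the coordinates $(x^i,y^i)$ with $y^j(\zeta)=\zeta^j$ for $\zeta=\sum_i\zeta^i\frac{\partial}{\partial x^i}$, and for $X,\zeta\in T_xM$ put $X^H_\zeta=\sum_i X^i\frac{\partial}{\partial x^i}-\sum_{i,j,k}\Gamma^k_{ij}X^iy^j(\zeta)\frac{\partial}{\partial y^k}$ and $X^V_\zeta=\sum_iX^i\frac{\partial}{\partial y^i}$. The almost Hermitian structure $(J^{\mathcal{D}},\widetilde g^{\mathcal{D}})$ on $TM$ is defined by $J^{\mathcal{D}}X^H_\zeta=X^V_\zeta$, $J^{\mathcal{D}}X^V_\zeta=-X^H_\zeta$, $\widetilde g^{\mathcal{D}}(X^H_\zeta,Y^H_\zeta)=\widetilde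 g^{\mathcal{D}}(X^V_\zeta,Y^V_\zeta)=g(X,Y)$, $\widetilde g^{\mathcal{D}}(X^H_\zeta,Y^V_\zeta)=0$. Kähler-Einstein means that this structure is Kähler and its metric is Einstein. *)

(* Defs.v *)
From HB Require Import structures.
From mathcomp Require Import all_boot all_order all_algebra.
From mathcomp Require Import all_classical all_reals all_analysis.
From mathcomp Require Import ring lra.

Set Implicit Arguments.
Unset Strict Implicit.
Unset Printing Implicit Defensive.

Import Order.TTheory GRing.Theory Num.Theory.
Import numFieldNormedType.Exports.

Local Open Scope classical_set_scope.
Local Open Scope ring_scope.

(** A manifold is an open set [M] of ['rV[R]_n], with [n = m.+1]; a point is
    its row of coordinates, and each tangent space is ['rV[R]_n].  All objects
    are total functions, of which only the values on [M] matter. *)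

Section Chart.
Context (R : realType) (m : nat).
Let n := m.+1.
Implicit Types (M : set 'rV[R]_n) (x u v w : 'rV[R]_n).
Implicit Types (X Y Z : 'rV[R]_n -> 'rV[R]_n).

(** C^oo on the open set [M]: every iterated directional derivative is
    differentiable at every point of [M]. *)
Definition smooth_on M (W : normedModType R) (f : 'rV[R]_n -> W) : Prop :=
  forall (vs : seq 'rV[R]_n) x, M x ->
    differentiable (foldr (fun v (h : 'rV[R]_n -> W) y => 'D_v h y) f vs) x.

Definition bform := 'rV[R]_n -> 'rV[R]_n -> 'rV[R]_n -> R.

Definition riemannian M (g : bform) : Prop :=
  [/\ forall v w, smooth_on M (fun x => g x v w : R^o),
      forall x, M x -> forall w, linear (fun v => g x v w : R^o),
      forall x, M x -> forall v w, g x v w = g x w v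
    & forall x, M x -> forall v, v != 0 -> 0 < g x v v].

(** [G x i j k] is the coefficient Gamma^k_ij at [x], i.e.
    D_{d/dx^i} (d/dx^j) = \sum_k Gamma^k_ij d/dx^k. *)
Definition connection := 'rV[R]_n -> 'I_n -> 'I_n -> 'I_n -> R.

Definition smooth_connection M (G : connection) : Prop :=
  forall i j k, smooth_on M (fun x => G x i j k : R^o).

Definition chris (G : connection) x v w : 'rV[R]_n :=
  \row_k \sum_i \sum_j G x i j k * v 0 i * w 0 j.

Definition cov (G : connection) X Y : 'rV[R]_n -> 'rV[R]_n :=
  fun x => 'D_(X x) Y x + chris G x (X x) (Y x).

Definition lie X Y : 'rV[R]_n -> 'rV[R]_n :=
  fun x => 'D_(X x) Y x - 'D_(Y x) X x.

(** Tensors are evaluated at tangent vectors by means of the extensions of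
    these to vector fields with constant coordinates. *)
Definition torsion (G : connection) x v w : 'rV[R]_n :=
  cov G (cst v) (cst w) x - cov G (cst w) (cst v) x - lie (cst v) (cst w) x.

Definition curvature (G : connection) x u v w : 'rV[R]_n :=
  cov G (cst u) (cov G (cst v) (cst w)) x
  - cov G (cst v) (cov G (cst u) (cst w)) x
  - cov G (lie (cst u) (cst v)) (cst w) x.

Definition flat M (G : connection) : Prop :=
  forall x, M x -> (forall v w, torsion G x v w = 0) /\
                   (forall u v w, curvature G x u v w = 0).

(** It is [G'] that is the dual connection of [G] with respect to [g]. *)
Definition dual_connection M (g : bform) (G G' : connection) : Prop :=
  forall X Y Z, smooth_on M X -> smooth_on M Y -> smooth_on M Z ->
  forall x, M x ->
    'D_(Z x) (fun y => g y (X y) (Y y) : R^o) x =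
    g x (cov G' Z X x) (Y x) + g x (X x) (cov G Z Y x).

Definition hessian_manifold M (g : bform) (G : connection) : Prop :=
  [/\ riemannian M g, smooth_connection M G, flat M G
    & exists G', [/\ smooth_connection M G', dual_connection M g G G' & flat M G']].

(** [cov1 G a x v w] is (D_v a)(w), for a 1-form [a]. *)
Definition cov1 (G : connection) (a : 'rV[R]_n -> 'rV[R]_n -> R) : bform :=
  fun x v w => 'D_v (fun y => a y w : R^o) x - a x (cov G (cst v) (cst w) x).

Definition diff1 (f : 'rV[R]_n -> R) : 'rV[R]_n -> 'rV[R]_n -> R :=
  fun x v => 'D_v (f : 'rV[R]_n -> R^o) x.

(** The [n]-forms take as argument the matrix [A] whose rows are [n] tangent
    vectors. *)
Definition topform := 'rV[R]_n -> 'M[R]_n -> R.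

Definition gram (g : bform) x : 'M[R]_n :=
  \matrix_(i, j) g x (delta_mx 0 i) (delta_mx 0 j).

Definition volume_form (g : bform) : topform :=
  fun x A => Num.sqrt (\det (gram g x)) * \det A.

Definition cov_top (G : connection) (om : topform) x v (A : 'M[R]_n) : R :=
  'D_v (fun y => om y A : R^o) x
  - \sum_i om x (\matrix_(k < n) if k == i
                                 then cov G (cst v) (cst (row i A)) x
                                 else row k A).

(** Inner product induced by [g] on [n]-forms, for which the squared norm of
    dx^1 /\ ... /\ dx^n is the inverse of the Gram determinant. *)
Definition inner_top (g : bform) x (s t : 'M[R]_n -> R) : R :=
  s 1%:M * t 1%:M / \det (gram g x).

Definition koszul1 (g : bform) (G : connection) x v : R :=
  inner_top g x (cov_top G (volume_form g) x v) (volume_form g x).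

Definition koszul2 (g : bform) (G : connection) : bform :=
  cov1 G (koszul1 g G).

Definition hesse_einstein M (g : bform) (G : connection) : Prop :=
  hessian_manifold M g G /\
  exists c : R, forall x, M x -> forall v w, koszul2 g G x v w = c * g x v w.

(** A metric connection is one that is its own dual. *)
Definition levi_civita M (g : bform) (G : connection) : Prop :=
  [/\ smooth_connection M G,
      forall x, M x -> forall v w, torsion G x v w = 0
    & dual_connection M g G G].

(** The Ricci tensor: (v, w) |-> trace of u |-> R(u, v) w. *)
Definition ricci (G : connection) : bform :=
  fun x v w => \sum_i (curvature G x (delta_mx 0 i) v w) 0 i.

Definition einstein M (g : bform) : Prop :=
  exists2 G : connection, levi_civita M g G &
  exists c : R, forall x, M x -> forall v w, ricci G x v w = c * g x v w.

Definition endo := 'rV[R]_n -> 'rV[R]_n -> 'rV[R]_n.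

Definition almost_complex M (J : endo) : Prop :=
  [/\ forall v, smooth_on M (fun x => J x v),
      forall x, M x -> linear (J x)
    & forall x, M x -> forall v, J x (J x v) = - v].

Definition nijenhuis (J : endo) x v w : 'rV[R]_n :=
  lie (J^~ v) (J^~ w) x - J x (lie (J^~ v) (cst w) x)
  - J x (lie (cst v) (J^~ w) x) - lie (cst v) (cst w) x.

Definition fundamental_form (g : bform) (J : endo) : bform :=
  fun x v w => g x (J x v) w.

(** Exterior derivative of a 2-form; the bracket terms vanish on vector fields
    with constant coordinates. *)
Definition dform2 (om : bform) x u v w : R :=
  'D_u (fun y => om y v w : R^o) x + 'D_v (fun y => om y w u : R^o) x
  + 'D_w (fun y => om y u v : R^o) x.

Definition kahler M (g : bform) (J : endo) : Prop :=
  [/\ riemannian M g, almost_complex M J,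
      forall x, M x -> forall v w, g x (J x v) (J x w) = g x v w,
      forall x, M x -> forall v w, nijenhuis J x v w = 0
    & forall x, M x -> forall u v w, dform2 (fundamental_form g J) x u v w = 0].

Definition kahler_einstein M (g : bform) (J : endo) : Prop :=
  kahler M g J /\ einstein M g.

End Chart.

(** A point of [TM] is the row [row_mx x y] of its coordinates (x^i, y^i). *)

Section TangentBundle.
Context (R : realType) (m : nat).
Let n := m.+1.
Variables (g : bform R m) (G : connection R m).
Implicit Types (z a b : 'rV[R]_(n + n)) (v w : 'rV[R]_n).

Definition tangent_bundle (M : set 'rV[R]_n) : set 'rV[R]_(n + n) :=
  [set z | M (lsubmx z)].

Definition hlift z v : 'rV[R]_(n + n) :=
  row_mx v (- chris G (lsubmx z) v (rsubmx z)).

Definition vlift v : 'rV[R]_(n + n) := row_mx 0 v.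

(** [a = hlift z (hpart a) + vlift (vpart z a)], see [hvlift_decomp]. *)
Definition hpart a : 'rV[R]_n := lsubmx a.

Definition vpart z a : 'rV[R]_n :=
  rsubmx a + chris G (lsubmx z) (lsubmx a) (rsubmx z).

Definition TJ : endo R (m + n) :=
  fun z a => vlift (hpart a) - hlift z (vpart z a).

Definition Tmetric : bform R (m + n) :=
  fun z a b => g (lsubmx z) (hpart a) (hpart b)
             + g (lsubmx z) (vpart z a) (vpart z b).

Lemma hpart_hlift z v : hpart (hlift z v) = v.
Proof. by rewrite /hpart row_mxKl. Qed.

Lemma vpart_hlift z v : vpart z (hlift z v) = 0.
Proof. by rewrite /vpart row_mxKl row_mxKr addNr. Qed.

Lemma chris0 x w : chris G x 0 w = 0.
Proof.
apply/rowP => k; rewrite !mxE.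
by apply: big1 => i _; apply: big1 => j _; rewrite mxE mulr0 mul0r.
Qed.

Lemma hpart_vlift v : hpart (vlift v) = 0.
Proof. by rewrite /hpart row_mxKl. Qed.

Lemma vpart_vlift z v : vpart z (vlift v) = v.
Proof. by rewrite /vpart row_mxKl row_mxKr chris0 addr0. Qed.

Lemma hvlift_decomp z a : a = hlift z (hpart a) + vlift (vpart z a).
Proof.
by rewrite add_row_mx addr0 addrCA addNr addr0 hsubmxK.
Qed.

Lemma TJ_hlift z v : TJ z (hlift z v) = vlift v.
Proof.
rewrite /TJ hpart_hlift vpart_hlift /hlift chris0 oppr0 row_mx0.
by rewrite subr0.
Qed.

Lemma TJ_vlift z v : TJ z (vlift v) = - hlift z v.
Proof. by rewrite /TJ hpart_vlift vpart_vlift /vlift row_mx0 sub0r. Qed.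

Section TmetricLifts.
Variables (M : set 'rV[R]_n) (z : 'rV[R]_(n + n)).
Hypotheses (gM : riemannian M g) (Mz : M (lsubmx z)).

Let g0 w : g (lsubmx z) 0 w = 0.
Proof.
case: gM => _ glin _ _.
by have := glin _ Mz w (-1) 0 0; rewrite scaler0 addr0 scaleN1r addNr.
Qed.

Lemma Tmetric_hh v w : Tmetric z (hlift z v) (hlift z w) = g (lsubmx z) v w.
Proof. by rewrite /Tmetric !hpart_hlift !vpart_hlift g0 addr0. Qed.

Lemma Tmetric_vv v w : Tmetric z (vlift v) (vlift w) = g (lsubmx z) v w.
Proof. by rewrite /Tmetric !hpart_vlift !vpart_vlift g0 add0r. Qed.

Lemma Tmetric_hv v w : Tmetric z (hlift z v) (vlift w) = 0.
Proof.
case: gM => _ _ gsym _.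
rewrite /Tmetric hpart_hlift vpart_hlift hpart_vlift vpart_vlift.
by rewrite g0 gsym// g0 addr0.
Qed.

End TmetricLifts.
End TangentBundle.

Section Model.
Context {R : realType}.
Variable (rho : 'rV[R]_2 -> 'M[R]_2).
Implicit Types (U : set 'rV[R]_2) (z : 'rV[R]_(2 + 2)).

Definition S2 : set 'M[R]_2 := [set A | A^T = A].

Definition S2_pos : set 'M[R]_2 :=
  [set A | S2 A /\ forall v : 'rV[R]_2, v != 0 -> 0 < (v *m A *m v^T) 0 0].

Definition density (mu xi x : 'rV[R]_2) : R :=
  Num.sqrt (\det (rho xi) / (2 * pi) ^+ 2) *
  expR (- (1 / 2) * ((x - mu) *m rho xi *m (x - mu)^T) 0 0).

Definition model U : set ('rV[R]_2 -> R) :=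
  [set p | exists mu xi, U xi /\ p = density mu xi].

(** [model U] is identified with its image R^2 x U in the global coordinates
    [z = row_mx theta xi], where theta = rho(xi) mu; see [model_chart_bij]. *)
Definition model_domain U : set 'rV[R]_(2 + 2) := [set z | U (rsubmx z)].

Definition model_chart z : 'rV[R]_2 -> R :=
  density (lsubmx z *m invmx (rho (rsubmx z))) (rsubmx z).

Definition potential z : R :=
  1 / 2 * ((lsubmx z *m invmx (rho (rsubmx z)) *m (lsubmx z)^T) 0 0
           - ln (\det (rho (rsubmx z)))).

Definition std_flat : connection R 3 := fun _ _ _ _ => 0.

(** The Fisher metric, as the Hessian metric D d[potential]. *)
Definition fisher : bform R 3 := cov1 std_flat (diff1 potential).

Lemma S2_pos_unit A : S2_pos A -> A \in unitmx.
Proof.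
move=> [_ Apos]; rewrite unitmxE unitfE; apply/det0P => -[v v0 vA].
by have := Apos _ v0; rewrite vA mul0mx mxE ltxx.
Qed.

Lemma S2_pos_det A : S2_pos A -> 0 < \det A.
Proof.
move=> [As Apos].
have A10 : A 1 0 = A 0 1 by have /matrixP/(_ 0 1) := As; rewrite mxE.
have quadE (v : 'rV[R]_2) : (v *m A *m v^T) 0 0 =
    v 0 0 ^+ 2 * A 0 0 + 2 * v 0 0 * v 0 1 * A 0 1 + v 0 1 ^+ 2 * A 1 1.
  rewrite !mxE !big_ord_recl !big_ord0 !mxE !big_ord_recl !big_ord0 /=.
  have -> : lift ord0 ord0 = 1 :> 'I_2 by apply/val_inj.
  by rewrite A10 -[ord0]/(0 : 'I_2); ring.
have detE : \det A = A 0 0 * A 1 1 - A 0 1 ^+ 2.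
  rewrite (expand_det_row _ 0) !big_ord_recl big_ord0 /cofactor !det_mx11 !mxE /=.
  have -> : lift ord0 ord0 = 1 :> 'I_2 by apply/val_inj.
  have -> : lift 1 0 = 0 :> 'I_2 by apply/val_inj.
  by rewrite A10 -[ord0]/(0 : 'I_2) /= expr0 expr1 addr0 mul1r; ring.
have A00 : 0 < A 0 0.
  have := Apos (delta_mx 0 0); rewrite quadE !mxE /= => H.
  have : (0 : R) < 1 ^+ 2 * A 0 0 + 2 * 1 * 0 * A 0 1 + 0 ^+ 2 * A 1 1.
    apply: H; apply/negP => /eqP/matrixP/(_ 0 0); rewrite !mxE /= => /eqP.
    by rewrite oner_eq0.
  by rewrite !expr2; lra.
pose w : 'rV[R]_2 := \row_i (if i == 0 then - A 0 1 else A 0 0).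
have := Apos w; rewrite quadE !mxE /= => H.
have : 0 < A 0 0 * \det A.
  rewrite detE.
  suff : 0 < (- A 0 1) ^+ 2 * A 0 0 + 2 * (- A 0 1) * A 0 0 * A 0 1
           + A 0 0 ^+ 2 * A 1 1 by move=> h; apply: (lt_le_trans h); lra.
  apply: H; apply/negP => /eqP/matrixP/(_ 0 1); rewrite !mxE /= => A0.
  by move: A00; rewrite A0 ltxx.
by rewrite pmulr_rgt0.
Qed.

Lemma ln_model_chart z (x : 'rV[R]_2) : S2_pos (rho (rsubmx z)) ->
  ln (model_chart z x) = (lsubmx z *m x^T) 0 0
    - 1 / 2 * (x *m rho (rsubmx z) *m x^T) 0 0 - potential z - ln (2 * pi).
Proof.
move=> Az; have [As _] := Az.
have d0 := S2_pos_det Az; have Au := S2_pos_unit Az.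
have p0 : 0 < 2 * pi :> R by rewrite mulr_gt0// pi_gt0.
rewrite /model_chart /density /potential.
move: (lsubmx z) (rho (rsubmx z)) (2 * pi) As d0 Au p0 => t A q As d0 Au p0 {Az}.
rewrite sqrtrM ?ltW// sqrtrV ?exprn_ge0 ?ltW// sqrtr_sqr gtr0_norm//.
have s0 : 0 < Num.sqrt (\det A) by rewrite sqrtr_gt0.
rewrite lnM ?posrE ?expR_gt0 ?divr_gt0// ln_div ?posrE// expRK.
have -> : ln (Num.sqrt (\det A)) = 1 / 2 * ln (\det A).
  rewrite -[in RHS](sqr_sqrtr (ltW d0)) expr2 lnM ?posrE//; lra.
have -> : ((x - t *m invmx A) *m A *m (x - t *m invmx A)^T) 0 0 =
    (x *m A *m x^T) 0 0 - 2 * (t *m x^T) 0 0 + (t *m invmx A *m t^T) 0 0.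
  have -> : (x - t *m invmx A) *m A = x *m A - t by rewrite mulmxBl mulmxKV.
  rewrite linearB /= mulmxBr !mulmxBl.
  have -> : x *m A *m (t *m invmx A)^T = (t *m x^T)^T.
    by rewrite !trmx_mul trmxK trmx_inv As mulmxA mulmxK.
  rewrite [(t *m invmx A)^T]trmx_mul trmx_inv As mulmxA !mxE; lra.
lra.
Qed.

Lemma model_chart_gt0 z (x : 'rV[R]_2) :
  S2_pos (rho (rsubmx z)) -> 0 < model_chart z x.
Proof.
move=> Az; rewrite mulr_gt0 ?expR_gt0// sqrtr_gt0 divr_gt0 ?S2_pos_det//.
by rewrite exprn_gt0// mulr_gt0// pi_gt0.
Qed.

Lemma model_chart_bij U : injective rho -> rho @` U `<=` S2_pos ->
  set_bij (model_domain U) (model U) model_chart.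
Proof.
move=> rinj rpos; split.
- by move=> z Uz; exists (lsubmx z *m invmx (rho (rsubmx z))), (rsubmx z).
- move=> z1 z2 /set_mem Uz1 /set_mem Uz2 e12.
  have P1 : S2_pos (rho (rsubmx z1)) by apply: rpos; exists (rsubmx z1).
  have P2 : S2_pos (rho (rsubmx z2)) by apply: rpos; exists (rsubmx z2).
  have E (x : 'rV[R]_2) := congr1 (fun f => ln (f x)) e12.
  have {}E (x : 'rV[R]_2) := etrans (esym (ln_model_chart x P1))
                               (etrans (E x) (ln_model_chart x P2)).
  have := E 0; rewrite trmx0 !mulmx0 mxE => E0.
  have EN (x : 'rV[R]_2) := E (- x).
  have N (A : 'M[R]_2) (x : 'rV[R]_2) : (- x) *m A *m (- x)^T = x *m A *m x^T.
    by rewrite linearN /= mulmxN !mulNmx opprK.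
  have Nt (t x : 'rV[R]_2) : (t *m (- x)^T) 0 0 = - (t *m x^T) 0 0.
    by rewrite linearN /= mulmxN mxE.
  have Et (x : 'rV[R]_2) : (lsubmx z1 *m x^T) 0 0 = (lsubmx z2 *m x^T) 0 0.
    by have := E x; have := EN x; rewrite !N !Nt; lra.
  have Eq (x : 'rV[R]_2) : (x *m rho (rsubmx z1) *m x^T) 0 0
                         = (x *m rho (rsubmx z2) *m x^T) 0 0.
    by have := E x; have := Et x; lra.
  pose e (i : 'I_2) : 'rV[R]_2 := delta_mx 0 i.
  have entry (A : 'M[R]_2) i j : A i j = (e i *m A *m (e j)^T) 0 0.
    by rewrite trmx_delta -rowE -colE !mxE.
  have pol (A : 'M[R]_2) i j : S2 A -> 2 * A i j =
      ((e i + e j) *m A *m (e i + e j)^T) 0 0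
      - (e i *m A *m (e i)^T) 0 0 - (e j *m A *m (e j)^T) 0 0.
    move=> As; have Aji : A j i = A i j by rewrite -[in LHS]As mxE.
    rewrite [(e i + e j)^T]linearD /= mulmxDr !mulmxDl.
    rewrite mxE [X in X + _ - _ - _]mxE [X in _ + X - _ - _]mxE -!entry Aji.
    lra.
  have rr : rho (rsubmx z1) = rho (rsubmx z2).
    apply/matrixP => i j; have [S1 _] := P1; have [S2' _] := P2.
    by have := pol _ i j S1; have := pol _ i j S2'; rewrite !Eq; lra.
  rewrite -(hsubmxK z1) -(hsubmxK z2) (rinj _ _ rr); congr row_mx.
  apply/rowP => i; have := Et (delta_mx 0 i).
  by rewrite trmx_delta -!colE !mxE.
- move=> p [mu [xi [Uxi ->]]]; exists (row_mx (mu *m rho xi) xi).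
    by rewrite /model_domain /= row_mxKr.
  have Pxi : S2_pos (rho xi) by apply: rpos; exists xi.
  by rewrite /model_chart row_mxKr row_mxKl mulmxK// S2_pos_unit.
Qed.

End Model.

(* Main.v *)
(* Write x = (theta, xi), H for the Hessian matrix of the potential and Gam for the
   Christoffel symbols of D*, so that D_v H = Gam_v H.  Hence Gam_v = (D_v H) H^-1,
   D* is flat, and the first Koszul form of D* is alpha = - 1/2 d log det H.  In two
   dimensions q = det rho(xi) is a quadratic form, and
   H = K diag(rho^-1, hess(- 1/2 log q)) K^T with K unipotent; this gives
   det H = C q^-3 with C constant.  By homogeneity g(x, .) = 1/2 d log q, so
   alpha = 3 g(x, .), and D*(g(x, .)) = g yields beta = 3 g.
   On TM, write X + i Y for the sum of the horizontal lift of X and the vertical lift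
   of Y.  In the frame of the lifts of constant fields, the Levi-Civita connection
   form in the direction h + i k is Gam_h - 1/2 Gam_(h + i k), where Gam is extended
   complex-linearly.  It commutes with i, so J is parallel, which gives the Kaehler
   property, and taking the trace of its curvature gives Ric = - beta = - 3 g on
   horizontal and on vertical vectors. *)
From HB Require Import structures.
Require Import Defs.
From mathcomp Require Import all_boot all_order all_algebra.
From mathcomp Require Import all_classical all_reals all_analysis.
From mathcomp Require Import ring lra.
Import Order.TTheory GRing.Theory Num.Theory.
Import numFieldNormedType.Exports.
Set Implicit Arguments.
Unset Strict Implicit.
Unset Printing Implicit Defensive.
Local Open Scope classical_set_scope.
Local Open Scope ring_scope.

(** * Elementary functions on an open set *)

(** In the affine coordinates of D*, given by the gradient of the potential, Gam would vanish and TM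
    would carry holomorphic coordinates. The statement, however, lives in the chart (theta, xi) of
    D, where Gam does not vanish; hence the moving frame of lifts and the change of gauge back to
    coordinates. The equation D_v H = Gam_v H is imposed by duality on every connection dual to D,
    so an arbitrary D* can be treated. The exponent 3 is 1 + 2: rho^-1 contributes q^-1, and the
    Hessian of - 1/2 log q has determinant C q^-2 because q is a quadratic form in exactly two
    variables. C depends on rho, but taking the logarithmic derivative removes it, so the Einstein
    constants are the same for every rho. *)

Section Elementary.
Context (R : realType) (p : nat).
Implicit Types (M : set 'rV[R]_p) (f h : 'rV[R]_p -> R) (u v x : 'rV[R]_p).

Lemma deriv_coord v x i : 'D_v (fun y : 'rV[R]_p => y 0 i : R^o) x = v 0 i.
Proof.
have dc : derivable id x v := @derivable_id _ _ _ _.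
by have := derive_mx dc; rewrite derive_id => /rowP/(_ i); rewrite mxE.
Qed.

Lemma deriv_plus f h v x : differentiable (f : _ -> R^o) x ->
  differentiable (h : _ -> R^o) x ->
  'D_v (fun y => f y + h y : R^o) x = 'D_v (f : _ -> R^o) x + 'D_v (h : _ -> R^o) x.
Proof. by move=> df dh; rewrite -deriveD//; exact: diff_derivable. Qed.

Lemma deriv_mult f h v x : differentiable (f : _ -> R^o) x ->
  differentiable (h : _ -> R^o) x ->
  'D_v (fun y => f y * h y : R^o) x =
  'D_v (f : _ -> R^o) x * h x + f x * 'D_v (h : _ -> R^o) x.
Proof.
move=> df dh; have := @deriveM R _ f h x v (diff_derivable df) (diff_derivable dh).
by rewrite /GRing.scale /= [h x * _]mulrC addrC => <-.
Qed.

Lemma deriv_scale f (c : R) v x : differentiable (f : _ -> R^o) x ->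
  'D_v (fun y => c * f y : R^o) x = c * 'D_v (f : _ -> R^o) x.
Proof.
move=> df; rewrite deriv_mult//.
by rewrite derive_cst mul0r add0r.
Qed.

Lemma deriv_inv f v x : f x != 0 -> differentiable (f : _ -> R^o) x ->
  'D_v (fun y => (f y)^-1 : R^o) x = - (f x ^- 2 * 'D_v (f : _ -> R^o) x).
Proof.
by move=> f0 df; rewrite deriveV//; [rewrite scaleNr | exact: diff_derivable].
Qed.

Lemma deriv_comp1 f (k : R -> R) dk v x : is_derive (f x) 1 (k : R -> R^o) dk ->
  differentiable (f : _ -> R^o) x ->
  'D_v (fun y => k (f y) : R^o) x = dk * 'D_v (f : _ -> R^o) x.
Proof.
move=> [dl <-] df; have {}dl : differentiable (k : R -> R^o) (f x).
  exact/derivable1_diffP.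
rewrite deriveE; last exact: (differentiable_comp df dl).
by rewrite (diff_comp df dl) /= -(deriveE v df) (diff1E dl) /= derive1E mulrC.
Qed.

Lemma differentiable_ln_comp f x : 0 < f x ->
  differentiable (f : _ -> R^o) x -> differentiable (fun y => ln (f y) : R^o) x.
Proof.
move=> f0 df; apply: (differentiable_comp df); apply/derivable1_diffP.
by apply: ex_derive; exact: is_derive1_ln.
Qed.

Lemma deriv_ln f v x : 0 < f x -> differentiable (f : _ -> R^o) x ->
  'D_v (fun y => ln (f y) : R^o) x = (f x)^-1 * 'D_v (f : _ -> R^o) x.
Proof. by move=> f0; apply: deriv_comp1; exact: is_derive1_ln. Qed.

(* The functions of this class are smooth and their mixed partial derivatives
   commute, both by induction; every function of the development belongs to it. *)
Inductive elem M : ('rV[R]_p -> R) -> Prop :=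
| elem_cst c : elem M (fun=> c)
| elem_coord i : elem M (fun x => x 0 i)
| elem_plus f h : elem M f -> elem M h -> elem M (fun x => f x + h x)
| elem_mult f h : elem M f -> elem M h -> elem M (fun x => f x * h x)
| elem_inv f : elem M f -> (forall x, M x -> f x != 0) -> elem M (fun x => (f x)^-1)
| elem_ln f : elem M f -> (forall x, M x -> 0 < f x) -> elem M (fun x => ln (f x))
| elem_ext f h : elem M f -> (forall x, M x -> f x = h x) -> elem M h.

Lemma elem_opp M f : elem M f -> elem M (fun x => - f x).
Proof.
move=> ef; apply: (elem_ext (elem_mult (elem_cst M (-1)) ef)) => x _.
by rewrite mulN1r.
Qed.

Lemma elem_sum M (I : Type) (s : seq I) (P : pred I) (F : I -> 'rV[R]_p -> R) :
  (forall i, elem M (F i)) -> elem M (fun x => \sum_(i <- s | P i) F i x).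
Proof.
move=> eF; elim: s => [|i s IH].
  by apply: (elem_ext (elem_cst M 0)) => x _; rewrite big_nil.
case Pi: (P i).
  by apply: (elem_ext (elem_plus (eF i) IH)) => x _; rewrite big_cons Pi.
by apply: (elem_ext IH) => x _; rewrite big_cons Pi.
Qed.

Lemma elem_prod M (I : Type) (s : seq I) (P : pred I) (F : I -> 'rV[R]_p -> R) :
  (forall i, elem M (F i)) -> elem M (fun x => \prod_(i <- s | P i) F i x).
Proof.
move=> eF; elim: s => [|i s IH].
  by apply: (elem_ext (elem_cst M 1)) => x _; rewrite big_nil.
case Pi: (P i).
  by apply: (elem_ext (elem_mult (eF i) IH)) => x _; rewrite big_cons Pi.
by apply: (elem_ext IH) => x _; rewrite big_cons Pi.
Qed.

Section OpenDomain.
Variables (M : set 'rV[R]_p) (oM : open M).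

Lemma near_open (T : Type) (f h : 'rV[R]_p -> T) x : M x ->
  (forall y, M y -> f y = h y) -> \near x, f x = h x.
Proof. by move=> Mx fh; apply: filterS (open_nbhs_nbhs (conj oM Mx)) => y /fh. Qed.

Lemma deriv_ext (W : normedModType R) (f h : 'rV[R]_p -> W) v x : M x ->
  (forall y, M y -> f y = h y) -> 'D_v f x = 'D_v h x.
Proof. by move=> Mx fh; apply: near_eq_derive; exact: near_open. Qed.

(** Serves to make differentiability at a point depend on the germ alone, see
    [differentiable_ext]. *)
Lemma differentiable_near0 (W : normedModType R) (f : 'rV[R]_p -> W) x :
  (\near x, f x = 0) -> differentiable f x.
Proof.
move=> f0; have fx0 : f x = 0 := nbhs_singleton f0.
(* The differential is obtained by choice, so it is enough to exhibit one map, here [\0], that meets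
   its specification [Q]. *)
apply/diffP; pose Q (df : {linear 'rV[R]_p -> W}) := continuous df /\
  forall y, f y = f (lim (nbhs x)) + df (y - lim (nbhs x))
                  +o_(y \near x) (y - lim (nbhs x)).
apply: (@getPex _ Q); exists (\0 : {linear 'rV[R]_p -> W}); split; first exact: cst_continuous.
have fo : f = (fun y => f (lim (nbhs x)) + \0 (y - lim (nbhs x)))
    +o_ x (fun y => y - lim (nbhs x)).
  apply/eqaddoP => e /= e0; apply: filterS f0 => y fy.
  rewrite !fctE lim_id// fx0 fy addr0 subrr normr0.
  by rewrite mulr_ge0// ltW.
by move=> y; rewrite {1}fo.
Qed.

Lemma differentiable_ext (W : normedModType R) (f h : 'rV[R]_p -> W) x : M x ->
  (forall y, M y -> f y = h y) -> differentiable f x -> differentiable h x.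
Proof.
move=> Mx fh df; have dh : differentiable (f + (h - f)) x.
  apply: (differentiableD df); apply: differentiable_near0.
  by apply: near_open => // y My; rewrite !fctE (fh y My) subrr.
by rewrite [h](_ : _ = f + (h - f)) //; apply/funext => y; rewrite !fctE addrC subrK.
Qed.

(** Both claims go through one induction: differentiability of the parts justifies the rule that
    exhibits the derivative as a member of the class. *)
Lemma elem_derive f : elem M f ->
  (forall x, M x -> differentiable (f : _ -> R^o) x) /\
  (forall v, elem M (fun x => 'D_v (f : _ -> R^o) x)).
Proof.
elim=> {f} [c|i|f h ef [df Df] eh [dh Dh]|f h ef [df Df] eh [dh Dh]
  |f ef [df Df] f0|f ef [df Df] f0|f h ef [df Df] fh].
- split=> [x _|v]; first exact: (differentiable_cst (c : R^o)).
  by apply: (elem_ext (elem_cst M 0)) => x _; rewrite derive_cst.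
- split=> [x _|v]; first exact: differentiable_coord.
  by apply: (elem_ext (elem_cst M (v 0 i))) => x _; apply/esym; exact: deriv_coord.
- split=> [x Mx|v]; first by apply: differentiableD; [exact: df | exact: dh].
  apply: (elem_ext (elem_plus (Df v) (Dh v))) => x Mx.
  by rewrite deriv_plus//; [exact: df | exact: dh].
- split=> [x Mx|v]; first by apply: differentiableM; [exact: df | exact: dh].
  apply: (elem_ext (elem_plus (elem_mult (Df v) eh) (elem_mult ef (Dh v)))) => x Mx.
  by rewrite deriv_mult//; [exact: df | exact: dh].
- split=> [x Mx|v]; first by apply: differentiableV; [exact: df | exact: f0].
  have f20 x : M x -> f x * f x != 0 by move=> Mx; rewrite mulf_neq0 ?f0.
  apply: (elem_ext (elem_opp (elem_mult (elem_inv (elem_mult ef ef) f20) (Df v)))).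
  by move=> x Mx; rewrite deriv_inv ?f0//; exact: df.
- split=> [x Mx|v].
    by apply: differentiable_ln_comp; [exact: f0 | exact: df].
  have f'0 x : M x -> f x != 0 by move=> Mx; rewrite gt_eqF// f0.
  apply: (elem_ext (elem_mult (elem_inv ef f'0) (Df v))) => x Mx.
  by rewrite deriv_ln ?f0//; exact: df.
- split=> [x Mx|v]; first exact: differentiable_ext (df x Mx).
  by apply: (elem_ext (Df v)) => x Mx; exact: deriv_ext.
Qed.

Lemma elem_differentiable f x : elem M f -> M x -> differentiable (f : _ -> R^o) x.
Proof. by move=> /elem_derive[+ _]; apply. Qed.

Lemma deriv_sum (I : Type) (s : seq I) (F : I -> 'rV[R]_p -> R) v x :
  (forall i, elem M (F i)) -> M x ->
  'D_v (fun y => \sum_(i <- s) F i y : R^o) x =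
  \sum_(i <- s) 'D_v (F i : _ -> R^o) x.
Proof.
move=> eF Mx; elim: s => [|i s IH].
  by rewrite big_nil; under eq_fun do rewrite big_nil; rewrite derive_cst.
rewrite big_cons -IH -deriv_plus; try by apply: elem_differentiable => //; exact: elem_sum.
by under eq_fun do rewrite big_cons.
Qed.

Lemma elem_D f v : elem M f -> elem M (fun x => 'D_v (f : _ -> R^o) x).
Proof. by move=> /elem_derive[_]. Qed.

Lemma derivE_plus f h v x : elem M f -> elem M h -> M x ->
  'D_v (fun y => f y + h y : R^o) x = 'D_v (f : _ -> R^o) x + 'D_v (h : _ -> R^o) x.
Proof. by move=> ef eh Mx; apply: deriv_plus; exact: elem_differentiable Mx. Qed.

Lemma derivE_mult f h v x : elem M f -> elem M h -> M x ->
  'D_v (fun y => f y * h y : R^o) x =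
  'D_v (f : _ -> R^o) x * h x + f x * 'D_v (h : _ -> R^o) x.
Proof. by move=> ef eh Mx; apply: deriv_mult; exact: elem_differentiable Mx. Qed.

Lemma derivE_inv f v x : elem M f -> (forall y, M y -> f y != 0) -> M x ->
  'D_v (fun y => (f y)^-1 : R^o) x =
  - 1 * ((f x)^-1 * (f x)^-1) * 'D_v (f : _ -> R^o) x.
Proof.
move=> ef f0 Mx; rewrite deriv_inv ?f0//; last exact: elem_differentiable Mx.
by rewrite expr2 invfM mulN1r mulNr.
Qed.

Lemma derivE_ln f v x : elem M f -> (forall y, M y -> 0 < f y) -> M x ->
  'D_v (fun y => ln (f y) : R^o) x = (f x)^-1 * 'D_v (f : _ -> R^o) x.
Proof.
move=> ef f0 Mx; apply: deriv_ln; first exact: f0.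
exact: elem_differentiable Mx.
Qed.

(** In each case the second derivative along [w] and [z] splits into terms that are visibly
    symmetric in [w] and [z] and terms with a second derivative of a smaller function, to which the
    induction hypothesis applies. *)
Lemma elem_derive_comm f u v x : elem M f -> M x ->
  'D_u (fun y => 'D_v (f : _ -> R^o) y : R^o) x =
  'D_v (fun y => 'D_u (f : _ -> R^o) y : R^o) x.
Proof.
have sum2 (b b' d d' s t : R) : b = b' -> d = d' -> s * b + t * d = s * b' + t * d'.
  by move=> -> ->.
move=> ef; elim: ef x => {f} [c|i|f h ef IHf eh IHh|f h ef IHf eh IHh
  |f ef IH f0|f ef IH f0|f h ef IH fh] x Mx.
- have z w : (fun y => 'D_w (fun=> c : R^o) y) = (cst 0 : 'rV[R]_p -> R^o).
    by apply/funext => y; rewrite derive_cst.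
  by rewrite !z !derive_cst.
- have z w : (fun y => 'D_w (fun x : 'rV[R]_p => x 0 i : R^o) y) = cst (w 0 i).
    by apply/funext => y; exact: deriv_coord.
  by rewrite (z u) (z v) !derive_cst.
- have E w z : 'D_w (fun y => 'D_z (fun t => f t + h t : R^o) y : R^o) x =
      'D_w (fun y => 'D_z (f : _ -> R^o) y : R^o) x +
      'D_w (fun y => 'D_z (h : _ -> R^o) y : R^o) x.
    rewrite (deriv_ext _ Mx (fun y My => derivE_plus z ef eh My)).
    by rewrite (derivE_plus _ (elem_D z ef) (elem_D z eh) Mx).
  exact: (etrans (E u v) (etrans (congr2 +%R (IHf x Mx) (IHh x Mx)) (esym (E v u)))).
- have E w z : 'D_w (fun y => 'D_z (fun t => f t * h t : R^o) y : R^o) x =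
      'D_w (fun y => 'D_z (f : _ -> R^o) y : R^o) x * h x +
      ('D_z (f : _ -> R^o) x * 'D_w (h : _ -> R^o) x +
       'D_w (f : _ -> R^o) x * 'D_z (h : _ -> R^o) x) +
      f x * 'D_w (fun y => 'D_z (h : _ -> R^o) y : R^o) x.
    have Df := elem_D z ef; have Dh := elem_D z eh.
    rewrite (deriv_ext _ Mx (fun y My => derivE_mult z ef eh My)).
    rewrite (derivE_plus _ (elem_mult Df eh) (elem_mult ef Dh) Mx).
    by rewrite (derivE_mult _ Df eh Mx) (derivE_mult _ ef Dh Mx) !addrA.
  have congr3 (a a' b b' c c' s t : R) : a = a' -> b = b' -> c = c' ->
    a * s + b + t * c = a' * s + b' + t * c' by move=> -> -> ->.
  apply: (etrans (E u v)); apply: (etrans _ (esym (E v u))).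
  exact: congr3 (IHf x Mx) (addrC _ _) (IHh x Mx).
- have ei : elem M (fun y => (f y)^-1) by exact: elem_inv.
  have ei2 := elem_mult (elem_cst M (- 1)) (elem_mult ei ei).
  have E w z : 'D_w (fun y => 'D_z (fun t => (f t)^-1 : R^o) y : R^o) x =
      2 * (f x)^-1 ^+ 3 * ('D_w (f : _ -> R^o) x * 'D_z (f : _ -> R^o) x) +
      - 1 * ((f x)^-1 * (f x)^-1) * 'D_w (fun y => 'D_z (f : _ -> R^o) y : R^o) x.
    have Df := elem_D z ef.
    rewrite (deriv_ext _ Mx (fun y My => derivE_inv z ef f0 My)).
    rewrite (derivE_mult _ ei2 Df Mx); congr (_ + _).
    rewrite (derivE_mult _ (elem_cst M _) (elem_mult ei ei) Mx) derive_cst.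
    rewrite (derivE_mult _ ei ei Mx) (derivE_inv _ ef f0 Mx).
    by move: ('D_w _ _) ('D_z _ _) (f x)^-1 => a b c; ring.
  apply: (etrans (E u v)); apply: (etrans _ (esym (E v u))).
  exact: sum2 (mulrC _ _) (IH x Mx).
- have f'0 y : M y -> f y != 0 by move=> My; rewrite gt_eqF// f0.
  have ei : elem M (fun y => (f y)^-1) by exact: elem_inv.
  have E w z : 'D_w (fun y => 'D_z (fun t => ln (f t) : R^o) y : R^o) x =
      - 1 * ((f x)^-1 * (f x)^-1) * ('D_w (f : _ -> R^o) x * 'D_z (f : _ -> R^o) x) +
      (f x)^-1 * 'D_w (fun y => 'D_z (f : _ -> R^o) y : R^o) x.
    have Df := elem_D z ef.
    rewrite (deriv_ext _ Mx (fun y My => derivE_ln z ef f0 My)).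
    by rewrite (derivE_mult _ ei Df Mx) (derivE_inv _ ef f'0 Mx) !mulrA.
  apply: (etrans (E u v)); apply: (etrans _ (esym (E v u))).
  exact: sum2 (mulrC _ _) (IH x Mx).
- have dd w y : M y -> 'D_w (h : _ -> R^o) y = 'D_w (f : _ -> R^o) y.
    by move=> My; apply: deriv_ext => // t Mt; rewrite fh.
  apply: (etrans (deriv_ext _ Mx (dd v))); apply: (etrans (IH x Mx)).
  exact: (esym (deriv_ext _ Mx (dd u))).
Qed.

End OpenDomain.
End Elementary.

Lemma mxDE (V : zmodType) m n (A B : 'M[V]_(m, n)) i j : (A + B) i j = A i j + B i j.
Proof. exact: mxE. Qed.

Lemma mxNE (V : zmodType) m n (A : 'M[V]_(m, n)) i j : (- A) i j = - A i j.
Proof. exact: mxE. Qed.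

(** * Differential calculus of matrix-valued functions *)

Section MatrixCalculus.
Context (R : realType) (p : nat).
Implicit Types (M : set 'rV[R]_p) (u v x : 'rV[R]_p) (a b c : nat).

Definition elemmx a b M (A : 'rV[R]_p -> 'M[R]_(a, b)) :=
  forall i j, elem M (fun x => A x i j).

Definition mxdiff a b (A : 'rV[R]_p -> 'M[R]_(a, b)) x :=
  forall i j, differentiable (fun y => A y i j : R^o) x.

Definition dmx a b v (A : 'rV[R]_p -> 'M[R]_(a, b)) x : 'M[R]_(a, b) :=
  \matrix_(i, j) 'D_v (fun y => A y i j : R^o) x.

Lemma elemmx_ext a b M (A B : 'rV[R]_p -> 'M[R]_(a, b)) :
  elemmx M A -> (forall x, M x -> A x = B x) -> elemmx M B.
Proof. by move=> eA AB i j; apply: (elem_ext (eA i j)) => x Mx; rewrite AB. Qed.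

Lemma elemmx_cst a b M (A : 'M[R]_(a, b)) : elemmx M (fun=> A).
Proof. by move=> i j; exact: elem_cst. Qed.

Lemma elemmx_id M : elemmx M id.
Proof. by move=> i j; rewrite (ord1 i); exact: elem_coord. Qed.

Lemma elemmx_add a b M (A B : 'rV[R]_p -> 'M[R]_(a, b)) :
  elemmx M A -> elemmx M B -> elemmx M (fun x => A x + B x).
Proof.
move=> eA eB i j; apply: (elem_ext (elem_plus (eA i j) (eB i j))) => x _.
by rewrite mxE.
Qed.

Lemma elemmx_opp a b M (A : 'rV[R]_p -> 'M[R]_(a, b)) :
  elemmx M A -> elemmx M (fun x => - A x).
Proof.
by move=> eA i j; apply: (elem_ext (elem_opp (eA i j))) => x _; rewrite mxE.
Qed.

Lemma elemmx_mul a b c M (A : 'rV[R]_p -> 'M[R]_(a, b))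
    (B : 'rV[R]_p -> 'M[R]_(b, c)) :
  elemmx M A -> elemmx M B -> elemmx M (fun x => A x *m B x).
Proof.
move=> eA eB i j.
have := elem_sum (index_enum 'I_b) predT (fun k => elem_mult (eA i k) (eB k j)).
by move/elem_ext; apply=> x _; rewrite mxE.
Qed.

Lemma elemmx_tr a b M (A : 'rV[R]_p -> 'M[R]_(a, b)) :
  elemmx M A -> elemmx M (fun x => (A x)^T).
Proof. by move=> eA i j; apply: (elem_ext (eA j i)) => x _; rewrite mxE. Qed.

Lemma elemmx_block a b c d M (A : 'rV[R]_p -> 'M[R]_(a, c))
    (B : 'rV[R]_p -> 'M[R]_(a, d)) (C : 'rV[R]_p -> 'M[R]_(b, c))
    (D : 'rV[R]_p -> 'M[R]_(b, d)) :
  elemmx M A -> elemmx M B -> elemmx M C -> elemmx M D ->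
  elemmx M (fun x => block_mx (A x) (B x) (C x) (D x)).
Proof.
move=> eA eB eC eD i j.
case: (split_ordP i) => k ->; case: (split_ordP j) => l ->.
- by apply: (elem_ext (eA k l)) => x _; rewrite block_mxEul.
- by apply: (elem_ext (eB k l)) => x _; rewrite block_mxEur.
- by apply: (elem_ext (eC k l)) => x _; rewrite block_mxEdl.
- by apply: (elem_ext (eD k l)) => x _; rewrite block_mxEdr.
Qed.

Lemma elem_det a M (A : 'rV[R]_p -> 'M[R]_a) :
  elemmx M A -> elem M (fun x => \det (A x)).
Proof.
move=> eA; apply: elem_sum => s; apply: elem_mult; first exact: elem_cst.
by apply: elem_prod => i; exact: eA.
Qed.

Lemma elemmx_inv a M (A : 'rV[R]_p -> 'M[R]_a) :
  elemmx M A -> (forall x, M x -> A x \in unitmx) ->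
  elemmx M (fun x => invmx (A x)).
Proof.
move=> eA uA i j.
have d0 x : M x -> \det (A x) != 0 by move=> Mx; rewrite -unitfE -unitmxE uA.
have ec : elem M (fun x => cofactor (A x) j i).
  apply: elem_mult; first exact: elem_cst.
  apply: elem_det => k l; apply: (elem_ext (eA (lift j k) (lift i l))) => x _.
  by rewrite !mxE.
apply: (elem_ext (elem_mult (elem_inv (elem_det eA) d0) ec)) => x Mx.
by rewrite /invmx uA// !mxE.
Qed.

Lemma mxdiff_mul a b c (A : 'rV[R]_p -> 'M[R]_(a, b))
    (B : 'rV[R]_p -> 'M[R]_(b, c)) x :
  mxdiff A x -> mxdiff B x -> mxdiff (fun x => A x *m B x) x.
Proof.
move=> dA dB i j.
have -> : (fun y => (A y *m B y) i j : R^o) = \sum_k (fun y => A y i k * B y k j).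
  by apply/funext => y; rewrite mxE fct_sumE.
by apply: differentiable_sum => k; apply: differentiableM; [exact: dA|exact: dB].
Qed.

Lemma mxdiff_tr a b (A : 'rV[R]_p -> 'M[R]_(a, b)) x :
  mxdiff A x -> mxdiff (fun x => (A x)^T) x.
Proof.
move=> dA i j; rewrite (_ : (fun y => _) = (fun y => A y j i)); first exact: dA.
by apply/funext => y; rewrite mxE.
Qed.

Lemma dmx_cst a b v (A : 'M[R]_(a, b)) x : dmx v (fun=> A) x = 0.
Proof. by apply/matrixP => i j; rewrite !mxE derive_cst. Qed.

Lemma dmx_add a b v (A B : 'rV[R]_p -> 'M[R]_(a, b)) x :
  mxdiff A x -> mxdiff B x ->
  dmx v (fun y => A y + B y) x = dmx v A x + dmx v B x.
Proof.
move=> dA dB; apply/matrixP => i j; rewrite !mxE.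
have -> : (fun y => (A y + B y) i j : R^o) = (fun y => A y i j + B y i j).
  by apply/funext => y; rewrite mxE.
by apply: deriv_plus; [exact: dA | exact: dB].
Qed.

Lemma dmx_opp a b v (A : 'rV[R]_p -> 'M[R]_(a, b)) x :
  mxdiff A x -> dmx v (fun y => - A y) x = - dmx v A x.
Proof.
move=> dA; apply/matrixP => i j; rewrite !mxE.
have -> : (fun y => (- A y) i j : R^o) = - (fun y => A y i j : R^o).
  by apply/funext => y; rewrite mxE.
by apply: deriveN; apply: diff_derivable; exact: dA.
Qed.

Lemma dmx_mul a b c v (A : 'rV[R]_p -> 'M[R]_(a, b))
    (B : 'rV[R]_p -> 'M[R]_(b, c)) x :
  mxdiff A x -> mxdiff B x ->
  dmx v (fun y => A y *m B y) x = dmx v A x *m B x + A x *m dmx v B x.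
Proof.
move=> dA dB; apply/matrixP => i j; rewrite !mxE -big_split /=.
have -> : (fun y => (A y *m B y) i j : R^o) = \sum_k (fun y => A y i k * B y k j).
  by apply/funext => y; rewrite mxE fct_sumE.
rewrite derive_sum => [|k].
  apply: eq_bigr => k _; rewrite !mxE.
  by rewrite -(deriv_mult _ (dA i k) (dB k j)).
by apply: diff_derivable; apply: differentiableM; [exact: dA|exact: dB].
Qed.

Lemma dmx_tr a b v (A : 'rV[R]_p -> 'M[R]_(a, b)) x :
  dmx v (fun y => (A y)^T) x = (dmx v A x)^T.
Proof.
apply/matrixP => i j; rewrite !mxE.
by under eq_fun do rewrite mxE.
Qed.

Lemma dmx_block a b c d v (A : 'rV[R]_p -> 'M[R]_(a, c))
    (B : 'rV[R]_p -> 'M[R]_(a, d)) (C : 'rV[R]_p -> 'M[R]_(b, c))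
    (D : 'rV[R]_p -> 'M[R]_(b, d)) x :
  dmx v (fun y => block_mx (A y) (B y) (C y) (D y)) x =
  block_mx (dmx v A x) (dmx v B x) (dmx v C x) (dmx v D x).
Proof.
apply/matrixP => i j; rewrite mxE.
case: (split_ordP i) => k ->; case: (split_ordP j) => l ->;
  rewrite ?block_mxEul ?block_mxEur ?block_mxEdl ?block_mxEdr mxE;
  by under eq_fun do rewrite ?block_mxEul ?block_mxEur ?block_mxEdl ?block_mxEdr.
Qed.

Lemma dmx_dirP a b (A : 'rV[R]_p -> 'M[R]_(a, b)) x :
  mxdiff A x -> linear (fun v => dmx v A x).
Proof.
move=> dA c u v; apply/matrixP => i j; rewrite !mxE !deriveE; try exact: dA.
by rewrite linearP.
Qed.

Lemma mxdiff_derivable a b (A : 'rV[R]_p -> 'M[R]_(a, b)) x v :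
  mxdiff A x -> derivable A x v.
Proof. by move=> dA; apply/derivable_mxP => i j; exact: diff_derivable. Qed.

Lemma derive_dmx a b v (A : 'rV[R]_p -> 'M[R]_(a, b)) x :
  mxdiff A x -> 'D_v A x = dmx v A x.
Proof. by move=> dA; rewrite derive_mx//; exact: mxdiff_derivable. Qed.

Lemma differentiable_mxdiff b (A : 'rV[R]_p -> 'rV[R]_b) x :
  differentiable A x <-> mxdiff A x.
Proof.
split=> [dA i j|dA].
  exact: (differentiable_comp dA (differentiable_coord _ i j)).
have -> : A = \sum_j (fun y => A y 0 j *: delta_mx 0 j).
  by apply/funext => y; rewrite fct_sumE -row_sum_delta.
by apply: differentiable_sum => j; apply: differentiableZl; exact: dA.
Qed.

Section OpenDomain.
Variables (M : set 'rV[R]_p) (oM : open M).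

Lemma elemmx_mxdiff a b (A : 'rV[R]_p -> 'M[R]_(a, b)) x :
  elemmx M A -> M x -> mxdiff A x.
Proof. by move=> eA Mx i j; exact: elem_differentiable (eA i j) Mx. Qed.

Lemma elemmx_dmx a b (A : 'rV[R]_p -> 'M[R]_(a, b)) v :
  elemmx M A -> elemmx M (dmx v A).
Proof.
by move=> eA i j; apply: (elem_ext (elem_D oM v (eA i j))) => x _; rewrite mxE.
Qed.

Lemma dmx_ext a b (A B : 'rV[R]_p -> 'M[R]_(a, b)) v x : M x ->
  (forall y, M y -> A y = B y) -> dmx v A x = dmx v B x.
Proof.
move=> Mx AB; apply/matrixP => i j; rewrite !mxE.
by apply: (deriv_ext oM _ Mx) => y My; rewrite AB.
Qed.

Lemma dmx_comm a b (A : 'rV[R]_p -> 'M[R]_(a, b)) u v x : elemmx M A -> M x ->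
  dmx u (dmx v A) x = dmx v (dmx u A) x.
Proof.
move=> eA Mx; apply/matrixP => i j.
have E w z : dmx z (dmx w A) x i j =
    'D_z (fun y => 'D_w (fun t => A t i j : R^o) y : R^o) x.
  by rewrite mxE; under eq_fun do rewrite mxE.
apply: (etrans (E v u)); apply: (etrans _ (esym (E u v))).
exact: (@elem_derive_comm _ _ _ oM (fun t => A t i j) u v x (eA i j) Mx).
Qed.

Lemma dmx_inv a (A : 'rV[R]_p -> 'M[R]_a) v x : elemmx M A ->
  (forall x, M x -> A x \in unitmx) -> M x ->
  dmx v (fun y => invmx (A y)) x = - (invmx (A x) *m dmx v A x *m invmx (A x)).
Proof.
move=> eA uA Mx; have eV := elemmx_inv eA uA.
have : dmx v (fun y => A y *m invmx (A y)) x = 0.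
  rewrite -(dmx_cst v 1%:M x); apply: dmx_ext => // y My.
  by rewrite mulmxV ?uA.
rewrite dmx_mul; try exact: elemmx_mxdiff Mx.
move/(congr1 (mulmx (invmx (A x)))); rewrite mulmx0 mulmxDr mulmxA mulKmx ?uA//.
by move/eqP; rewrite addrC addr_eq0 => /eqP.
Qed.

End OpenDomain.
End MatrixCalculus.

Section Smooth.
Context (R : realType) (m : nat) (M : set 'rV[R]_m.+1) (oM : open M).

Lemma elem_smooth (f : 'rV[R]_m.+1 -> R) : elem M f -> smooth_on M (f : _ -> R^o).
Proof.
move=> ef vs x Mx; apply: (elem_differentiable oM) (Mx).
by elim: vs => [|v vs IH] //=; exact: elem_D.
Qed.

Lemma elemmx_smooth b (A : 'rV[R]_m.+1 -> 'rV[R]_b) : elemmx M A -> smooth_on M A.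
Proof.
move=> eA vs x Mx; apply/differentiable_mxdiff; apply: (elemmx_mxdiff oM) (Mx).
elim: vs => [|v vs IH] //=; apply: (elemmx_ext (elemmx_dmx oM v IH)) => y My.
by apply/esym/derive_dmx; exact: (elemmx_mxdiff oM IH My).
Qed.

Lemma smooth_mxdiff b (A : 'rV[R]_m.+1 -> 'rV[R]_b) x :
  smooth_on M A -> M x -> mxdiff A x.
Proof. by move=> sA Mx; apply/differentiable_mxdiff; exact: (sA [::]). Qed.

End Smooth.

(** * Connections as matrix-valued forms *)

Section Connections.
Context (R : realType).

(* [cm (G x) v] is the matrix, acting on row vectors from the right, of
   [w |-> chris G x v w]. *)
Definition cm n (K : 'I_n -> 'I_n -> 'I_n -> R) (v : 'rV[R]_n) : 'M[R]_n :=
  \matrix_(j, k) \sum_i K i j k * v 0 i.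

Lemma cmP n (K : 'I_n -> 'I_n -> 'I_n -> R) : linear (cm K).
Proof.
move=> c u v; apply/matrixP => j k; rewrite !mxE mulr_sumr -big_split /=.
by apply: eq_bigr => i _; rewrite !mxE; ring.
Qed.

HB.instance Definition _ n (K : 'I_n -> 'I_n -> 'I_n -> R) :=
  GRing.isLinear.Build R 'rV[R]_n 'M[R]_n _ (cm K) (cmP K).

Definition bil n (H : 'M[R]_n) (v w : 'rV[R]_n) : R := (v *m H *m w^T) 0 0.

Lemma bil_delta n (H : 'M[R]_n) i j : bil H (delta_mx 0 i) (delta_mx 0 j) = H i j.
Proof. by rewrite /bil trmx_delta -rowE -colE !mxE. Qed.

Lemma bil_tr n (H : 'M[R]_n) v w : bil H v w = bil H^T w v.
Proof.
rewrite /bil; have -> : w *m H^T *m v^T = (v *m H *m w^T)^T.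
  by rewrite !trmx_mul trmxK mulmxA.
by rewrite [RHS]mxE.
Qed.

Lemma bil_sym n (H : 'M[R]_n) v w : H^T = H -> bil H v w = bil H w v.
Proof. by move=> sH; rewrite bil_tr sH. Qed.

Lemma bil_inj n (H H' : 'M[R]_n) : (forall v w, bil H v w = bil H' v w) -> H = H'.
Proof. by move=> HH'; apply/matrixP => i j; rewrite -!bil_delta HH'. Qed.

Lemma bilDl n (H : 'M[R]_n) u v w : bil H (u + v) w = bil H u w + bil H v w.
Proof. by rewrite /bil !mulmxDl mxE. Qed.

Lemma bil_mul n (H A B : 'M[R]_n) v w : bil (A *m H *m B^T) v w = bil H (v *m A) (w *m B).
Proof. by rewrite /bil trmx_mul !mulmxA. Qed.

Lemma bil_block p q (P : 'M[R]_p) (Q : 'M[R]_q)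
    (a c : 'rV[R]_p) (b d : 'rV[R]_q) :
  bil (block_mx P 0 0 Q) (row_mx a b) (row_mx c d) = bil P a c + bil Q b d.
Proof.
by rewrite /bil mul_row_block !mulmx0 addr0 add0r tr_row_mx mul_row_col mxDE.
Qed.

Lemma posdef_unit k (H : 'M[R]_k) : (forall v, v != 0 -> 0 < bil H v v) -> H \in unitmx.
Proof.
move=> pH; rewrite unitmxE unitfE; apply/det0P => -[v v0 vA].
by have := pH _ v0; rewrite /bil vA mul0mx mxE ltxx.
Qed.

(** Passes from a linear family of matrices to connection coefficients; this is how [dual_conn],
    [tangent_lc] and [rho] enter the [cm] calculus. *)
Lemma cm_of_linear n (L : 'rV[R]_n -> 'M[R]_n) v :
  linear L -> cm (fun i j k => L (delta_mx 0 i) j k) v = L v.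
Proof.
move=> linL; pose LL := GRing.isLinear.Build R 'rV[R]_n 'M[R]_n _ L linL.
pose Lx : {linear 'rV[R]_n -> 'M[R]_n} := HB.pack L LL.
have -> : L v = \sum_i v 0 i *: L (delta_mx 0 i).
  rewrite -[LHS]/(Lx v) {1}(row_sum_delta v) linear_sum.
  by apply: eq_bigr => i _; rewrite linearZ.
apply/matrixP => j k; rewrite mxE summxE; apply: eq_bigr => i _.
by rewrite mxE mulrC.
Qed.

Lemma dmx_cm p n (K : 'rV[R]_p -> 'I_n -> 'I_n -> 'I_n -> R)
    (V : 'rV[R]_p -> 'rV[R]_n) a z :
  (forall i j k, differentiable (fun y => K y i j k : R^o) z) -> mxdiff V z ->
  dmx a (fun y => cm (K y) (V y)) z =
  cm (fun i j k => 'D_a (fun y => K y i j k : R^o) z) (V z) + cm (K z) (dmx a V z).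
Proof.
move=> dK dV; apply/matrixP => j k; rewrite !mxE -big_split /=.
have -> : (fun y => cm (K y) (V y) j k : R^o) =
    \sum_i (fun y => K y i j k * V y 0 i).
  by apply/funext => y; rewrite mxE fct_sumE.
rewrite derive_sum => [|i].
  apply: eq_bigr => i _; rewrite mxE.
  by rewrite -(deriv_mult _ (dK i j k) (dV 0 i)).
by apply: diff_derivable; apply: differentiableM; [exact: dK|exact: dV].
Qed.

Lemma elemmx_cm p n (N : set 'rV[R]_p) (K : 'rV[R]_p -> 'I_n -> 'I_n -> 'I_n -> R)
    (V : 'rV[R]_p -> 'rV[R]_n) :
  (forall i j k, elem N (fun y => K y i j k)) -> elemmx N V ->
  elemmx N (fun y => cm (K y) (V y)).
Proof.
move=> eK eV j k.
have := elem_sum (index_enum 'I_n) predT (fun i => elem_mult (eK i j k) (eV 0 i)).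
by move/elem_ext; apply=> x _; rewrite mxE.
Qed.

Variable m : nat.
Let n := m.+1.
Implicit Types (G : connection R m) (x u v w : 'rV[R]_n).

Lemma chris_cm G x v w : chris G x v w = w *m cm (G x) v.
Proof.
apply/rowP => k; rewrite !mxE exchange_big /=; apply: eq_bigr => j _.
by rewrite mxE mulr_sumr; apply: eq_bigr => i _; ring.
Qed.

Lemma cov_cst G v w : cov G (cst v) (cst w) = fun x => w *m cm (G x) v.
Proof. by apply/funext => x; rewrite /cov derive_cst add0r chris_cm. Qed.

Lemma lie_cst v w : lie (cst v) (cst w) = cst 0.
Proof. by apply/funext => x; rewrite /lie !derive_cst subr0. Qed.

Lemma torsionE G x v w : torsion G x v w = w *m cm (G x) v - v *m cm (G x) w.
Proof. by rewrite /torsion !cov_cst lie_cst subr0. Qed.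

Variables (M : set 'rV[R]_n) (oM : open M).

(** Matrices act on rows from the right, so D_u D_v produces [cm (G x) v *m cm (G x) u], in reverse
    of the usual order. *)
Definition curvmx G x u v : 'M[R]_n :=
  dmx u (fun y => cm (G y) v) x - dmx v (fun y => cm (G y) u) x
  + cm (G x) v *m cm (G x) u - cm (G x) u *m cm (G x) v.

Lemma elemmx_conn G v : (forall i j k, elem M (fun x => G x i j k)) ->
  elemmx M (fun x => cm (G x) v).
Proof. by move=> eG; apply: elemmx_cm => //; exact: elemmx_cst. Qed.

Lemma curvatureE G x u v w : (forall i j k, elem M (fun x => G x i j k)) -> M x ->
  curvature G x u v w = w *m curvmx G x u v.
Proof.
move=> eG Mx; rewrite /curvature !cov_cst lie_cst.
have -> : cov G (cst 0) (cst w) x = 0 by rewrite cov_cst linear0 mulmx0.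
have E a b : cov G (cst a) (fun y => w *m cm (G y) b) x =
    w *m (dmx a (fun y => cm (G y) b) x + cm (G x) b *m cm (G x) a).
  have eb := elemmx_conn b eG; have ew := elemmx_cst M w.
  rewrite /cov chris_cm derive_dmx; last first.
    exact: elemmx_mxdiff oM _ _ _ _ (elemmx_mul ew eb) Mx.
  rewrite dmx_mul; try by apply: (elemmx_mxdiff oM) Mx.
  by rewrite dmx_cst mul0mx add0r mulmxDr mulmxA.
rewrite !E subr0 -mulmxBr /curvmx; congr mulmx.
by rewrite opprD addrACA addrA.
Qed.

(** The derivatives of [X] and [Y] cancel by the product rule, so duality for all fields reduces to
    constant ones, hence to a matrix identity. With [G' = G] it expresses that a connection is
    metric. *)
Lemma dual_connectionP (g : bform R m) (H : 'rV[R]_n -> 'M[R]_n) G G' :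
  elemmx M H -> (forall x, M x -> forall v w, g x v w = bil (H x) v w) ->
  (forall x, M x -> forall v,
     dmx v H x = cm (G' x) v *m H x + H x *m (cm (G x) v)^T) <->
  dual_connection M g G G'.
Proof.
move=> eH gH; split=> [dH X Y Z sX sY sZ x Mx|dual x Mx v].
  have dX := smooth_mxdiff sX Mx; have dY := smooth_mxdiff sY Mx.
  have dHx := elemmx_mxdiff oM eH Mx.
  rewrite !gH// (deriv_ext oM (h := fun y => bil (H y) (X y) (Y y)) _ Mx); last first.
    by move=> y My; rewrite gH.
  have -> : 'D_(Z x) (fun y => bil (H y) (X y) (Y y) : R^o) x =
      dmx (Z x) (fun y => X y *m H y *m (Y y)^T) x 0 0 by rewrite mxE.
  rewrite dmx_mul; [|exact: mxdiff_mul|exact: mxdiff_tr].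
  rewrite dmx_mul// dmx_tr dH// /cov !derive_dmx// !chris_cm /bil.
  rewrite !(linearD (trmx)) /= !trmx_mul !mulmxDl !mulmxDr !mulmxDl !mulmxA !mxE.
  ring.
apply: bil_inj => a b.
have := dual (cst a) (cst b) (cst v).
have sm (c : 'rV[R]_n) : smooth_on M (cst c) by apply: (elemmx_smooth oM); exact: elemmx_cst.
move=> /(_ (sm a) (sm b) (sm v) x Mx); rewrite !gH// !cov_cst /=.
rewrite (deriv_ext oM (h := fun y => bil (H y) a b) _ Mx); last first.
  by move=> y My; rewrite gH.
have -> : 'D_v (fun y => bil (H y) a b : R^o) x =
    dmx v (fun y => a *m H y *m b^T) x 0 0 by rewrite mxE.
have dHx := elemmx_mxdiff oM eH Mx.
have dc c d (A : 'M[R]_(c, d)) : mxdiff (fun=> A) x.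
  exact: (elemmx_mxdiff oM (elemmx_cst M A) Mx).
rewrite dmx_mul; [|exact: mxdiff_mul|exact: dc].
rewrite dmx_mul// !dmx_cst mul0mx add0r mulmx0 addr0 -/(bil _ _ _) => ->.
by rewrite /bil trmx_mul mulmxDr mulmxDl !mulmxA [RHS]mxE.
Qed.

Lemma riemannianP (g : bform R m) (H : 'rV[R]_n -> 'M[R]_n) :
  elemmx M H -> (forall x, M x -> forall v w, g x v w = bil (H x) v w) ->
  (forall x, M x -> (H x)^T = H x) ->
  (forall x, M x -> forall v, v != 0 -> 0 < bil (H x) v v) -> riemannian M g.
Proof.
move=> eH gH sH pH; split=> [v w|x Mx w c u v|x Mx v w|x Mx v v0].
- apply: (elem_smooth oM).
  have := elemmx_mul (elemmx_mul (elemmx_cst M v) eH) (elemmx_cst M w^T).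
  by move=> /(_ 0 0)/elem_ext; apply=> x Mx; rewrite gH.
- by rewrite !gH// bilDl; congr (_ + _); rewrite /bil -!scalemxAl mxE.
- by rewrite !gH// bil_sym// sH.
- by rewrite gH// pH.
Qed.

End Connections.

(** * Jacobi's formula for the derivative of a determinant *)

Section Jacobi.
Context (R : realType) (p : nat) (M : set 'rV[R]_p) (oM : open M).

Lemma deriv_prod (I : eqType) (s : seq I) (F : I -> 'rV[R]_p -> R) v x :
  uniq s -> (forall i, elem M (F i)) -> M x ->
  'D_v (fun y => \prod_(i <- s) F i y : R^o) x =
  \sum_(i <- s) 'D_v (F i : _ -> R^o) x * \prod_(j <- s | j != i) F j x.
Proof.
move=> + eF Mx; elim: s => [_|i s IH /= /andP[si us]].
  by rewrite big_nil; under eq_fun do rewrite big_nil; rewrite derive_cst.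
under eq_fun do rewrite big_cons.
rewrite deriv_mult; try exact: elem_differentiable oM _ _ (eF i) Mx; last first.
  exact: elem_differentiable oM _ _ (elem_prod s predT eF) Mx.
rewrite IH// !big_cons eqxx /=; congr (_ * _ + _).
  rewrite -[RHS]big_filter (_ : [seq j <- s | j != i] = s)//.
  by apply/all_filterP/allP => j js; apply: contraNneq si => <-.
rewrite mulr_sumr; apply: eq_big_seq => k ks.
by rewrite big_cons ifT; [ring | apply: contraNneq si => ->].
Qed.

(** Laplace expansion along row [i], whose cofactors do not see that row. It serves both Jacobi's
    formula and the trace in the covariant derivative of the volume form. *)
Lemma det_row_replace n (A : 'M[R]_n) (r : 'rV[R]_n) i :
  \det (\matrix_(k < n) if k == i then r else row k A) = (r *m \adj A) 0 i.
Proof.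
rewrite (expand_det_row _ i) mxE; apply: eq_bigr => j _.
rewrite !mxE eqxx; congr (_ * (_ * \det _)).
by apply/matrixP => k l; rewrite !mxE eq_sym (negbTE (neq_lift i k)) !mxE.
Qed.

Lemma deriv_det n (A : 'rV[R]_p -> 'M[R]_n) v x : elemmx M A -> M x ->
  'D_v (fun y => \det (A y) : R^o) x = \tr (dmx v A x *m \adj (A x)).
Proof.
move=> eA Mx; rewrite /determinant (deriv_sum oM) => [|s|//]; last first.
  by apply: elem_mult; [exact: elem_cst | apply: elem_prod => i; exact: eA].
(* [B i] is [A] with row [i] differentiated, which is what the product rule makes of the Leibniz
   formula. *)
pose B i : 'M[R]_n := \matrix_(k < n) if k == i then row i (dmx v A x) else row k (A x).
transitivity (\sum_i \det (B i)); last first.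
  by apply: eq_bigr => i _; rewrite /B det_row_replace -row_mul mxE.
rewrite exchange_big /=; apply: eq_bigr => s _.
rewrite deriv_scale; last first.
  by apply: (elem_differentiable oM) Mx; apply: elem_prod => i; exact: eA.
rewrite deriv_prod ?index_enum_uniq// mulr_sumr; apply: eq_bigr => i _.
congr (_ * _); rewrite [RHS](bigD1 i)//= !mxE eqxx !mxE; congr (_ * _).
by apply: eq_bigr => j ji; rewrite !mxE (negbTE ji) mxE.
Qed.

End Jacobi.

(** * Hessian structures *)

Section HessianStructure.
Context (R : realType) (m : nat).
Let n := m.+1.
Variables (M : set 'rV[R]_n) (H : 'rV[R]_n -> 'M[R]_n) (g : bform R m).
Hypotheses (oM : open M) (eH : elemmx M H).
Hypothesis gH : forall x, M x -> forall v w, g x v w = bil (H x) v w.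
Hypothesis sH : forall x, M x -> (H x)^T = H x.
Hypothesis pH : forall x, M x -> forall v, v != 0 -> 0 < bil (H x) v v.
Hypothesis codazzi : forall x, M x -> forall u w, w *m dmx u H x = u *m dmx w H x.
Implicit Types (G : connection R m) (x u v w : 'rV[R]_n).

Let D : connection R m := fun _ _ _ _ => 0.

Lemma cm_zero x v : cm (D x) v = 0.
Proof. by apply/matrixP => j k; rewrite !mxE big1// => i _; rewrite mul0r. Qed.

Lemma hess_unit x : M x -> H x \in unitmx.
Proof. by move=> Mx; apply: posdef_unit; exact: pH. Qed.

Let dH x : M x -> mxdiff H x := elemmx_mxdiff oM eH.

Lemma dmx_hess_sym x v : M x -> (dmx v H x)^T = dmx v H x.
Proof. by move=> Mx; rewrite -dmx_tr; apply: (dmx_ext oM). Qed.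

Definition dual_conn : connection R m :=
  fun x i j k => (dmx (delta_mx 0 i) H x *m invmx (H x)) j k.

Lemma cm_dual_conn x v : M x -> cm (dual_conn x) v = dmx v H x *m invmx (H x).
Proof.
move=> Mx; apply: (cm_of_linear (L := fun v => dmx v H x *m invmx (H x))).
by move=> c a b; rewrite (dmx_dirP (dH Mx)) mulmxDl scalemxAl.
Qed.

Lemma dual_conn_dual : dual_connection M g D dual_conn.
Proof.
apply/(dual_connectionP oM D dual_conn eH gH) => x Mx v.
by rewrite cm_zero trmx0 mulmx0 addr0 cm_dual_conn// mulmxKV// hess_unit.
Qed.

Section DualConnection.
Variables (G : connection R m) (dualG : dual_connection M g D G).

Lemma dmx_hess x v : M x -> dmx v H x = cm (G x) v *m H x.
Proof.
move=> Mx; have := (dual_connectionP oM D G eH gH).2 dualG x Mx v.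
by rewrite cm_zero trmx0 mulmx0 addr0.
Qed.

(** Duality to [D] determines the connection on [M]; what follows therefore holds for any dual
    connection and not only for [dual_conn]. *)
Lemma cm_dual x v : M x -> cm (G x) v = dmx v H x *m invmx (H x).
Proof. by move=> Mx; rewrite dmx_hess// mulmxK// hess_unit. Qed.

Lemma elem_dual i j k : elem M (fun x => G x i j k).
Proof.
have eV := elemmx_inv eH hess_unit.
have := elemmx_mul (elemmx_dmx oM (delta_mx 0 i) eH) eV.
move=> /(_ j k)/elem_ext; apply=> x Mx; rewrite -cm_dual// mxE.
rewrite (bigD1 i)//= big1 => [|l li]; first by rewrite addr0 mxE !eqxx mulr1.
by rewrite mxE (negbTE li) andbF mulr0.
Qed.

(** The Codazzi equation of [H], read through [cm_dual], is the vanishing of the torsion. *)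
Lemma dual_sym x v w : M x -> w *m cm (G x) v = v *m cm (G x) w.
Proof. by move=> Mx; rewrite (cm_dual v Mx) (cm_dual w Mx) !mulmxA (codazzi Mx v w). Qed.

Let ecm v : elemmx M (fun x => cm (G x) v) := elemmx_conn v elem_dual.

(* With [cm (G x) v = (D_v H) H^-1], the part of [D_u (cm (G x) v) + cm v cm u]
   that survives is [(D_u D_v H) H^-1], symmetric in [u] and [v]: this is flatness. *)
Lemma dmx_cm_dual x u v : M x -> dmx u (fun y => cm (G y) v) x =
  dmx u (dmx v H) x *m invmx (H x) - cm (G x) v *m cm (G x) u.
Proof.
move=> Mx; have eV := elemmx_inv eH hess_unit.
have cE y : M y -> cm (G y) v = dmx v H y *m invmx (H y) by move=> My; exact: cm_dual.
rewrite (dmx_ext oM u Mx cE).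
have edH := elemmx_dmx oM v eH.
rewrite (dmx_mul _ (elemmx_mxdiff oM edH Mx) (elemmx_mxdiff oM eV Mx)).
rewrite (dmx_inv oM _ eH hess_unit Mx) (cm_dual u Mx) (cm_dual v Mx).
by rewrite mulmxN; congr (_ - _); rewrite -!mulmxA.
Qed.

Lemma dual_flat_eq x u v : M x ->
  dmx u (fun y => cm (G y) v) x - dmx v (fun y => cm (G y) u) x =
  cm (G x) u *m cm (G x) v - cm (G x) v *m cm (G x) u.
Proof.
move=> Mx; rewrite (dmx_cm_dual u v Mx) (dmx_cm_dual v u Mx) (dmx_comm oM u v eH Mx).
by rewrite opprB [LHS]addrC addrA subrK.
Qed.

Lemma dual_flat : flat M G.
Proof.
move=> x Mx; split=> [v w|u v w]; first by rewrite torsionE dual_sym// subrr.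
rewrite (curvatureE oM)//; last exact: elem_dual.
by rewrite /curvmx (dual_flat_eq u v Mx) subrK subrr mulmx0.
Qed.

Lemma dual_hessian_manifold : hessian_manifold M g G.
Proof.
split.
- exact: (riemannianP oM eH).
- by move=> i j k; apply: (elem_smooth oM); exact: elem_dual.
- exact: dual_flat.
exists D; split.
- by move=> i j k; apply: (elem_smooth oM); exact: elem_cst.
(* Transposing [dmx_hess], with both [H] and [dmx v H] symmetric, exchanges the roles of [D] and
   [G]. *)
- apply/(dual_connectionP oM G D eH gH) => x Mx v.
  rewrite cm_zero mul0mx add0r -[in RHS](sH Mx) -trmx_mul -dmx_hess//.
  by rewrite dmx_hess_sym.
- move=> x Mx; split=> [v w|u v w].
    by rewrite torsionE !cm_zero !mulmx0 subrr.
  rewrite (curvatureE oM)//; last by move=> i j k; exact: elem_cst.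
  have z a : (fun y => cm (D y) a) = fun=> 0 by apply/funext => y; rewrite cm_zero.
  by rewrite /curvmx !z !cm_zero !dmx_cst !mulmx0 !(subr0, addr0) mulmx0.
Qed.

Lemma gram_hess x : M x -> gram g x = H x.
Proof. by move=> Mx; apply/matrixP => i j; rewrite mxE gH// bil_delta. Qed.

(** By Jacobi's formula the derivative of the square root of [\det (H x)] contributes half of the
    trace, while the action of the connection on the frame subtracts the whole of it: the
    coefficient is 1/2 - 1. *)
Lemma koszul1E x v : 0 < \det (H x) -> M x ->
  koszul1 g G x v = - (1 / 2) * \tr (cm (G x) v).
Proof.
move=> d0 Mx; rewrite /koszul1 /inner_top /cov_top /volume_form det1.
have -> : 'D_v (fun y => Num.sqrt (\det (gram g y)) * 1 : R^o) x =
    (2 * Num.sqrt (\det (H x)))^-1 * (\det (H x) * \tr (cm (G x) v)).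
  have eD := elem_det eH.
  rewrite (deriv_ext oM (h := fun y => Num.sqrt (\det (H y))) _ Mx); last first.
    by move=> y My; rewrite gram_hess// mulr1.
  rewrite (deriv_comp1 v (is_derive1_sqrt d0) (elem_differentiable oM eD Mx)).
  congr (_ * _); rewrite (deriv_det oM)// dmx_hess// -mulmxA mul_mx_adj.
  by rewrite mul_mx_scalar mxtraceZ.
have -> : \sum_i Num.sqrt (\det (gram g x)) *
    \det (\matrix_(k < n) if k == i then cov G (cst v) (cst (row i 1%:M)) x
                          else row k 1%:M) =
    Num.sqrt (\det (H x)) * \tr (cm (G x) v).
  rewrite gram_hess// -mulr_sumr; congr (_ * _); apply: eq_bigr => i _.
  by rewrite det_row_replace adj1 mulmx1 cov_cst /= -row_mul mul1mx mxE.
rewrite gram_hess//; have s0 : 0 < Num.sqrt (\det (H x)) by rewrite sqrtr_gt0.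
move: (\tr _) s0 (sqr_sqrtr (ltW d0)) => t; move: (Num.sqrt _) => s s0 <-.
by field; rewrite gt_eqF.
Qed.

(** As [dmx v H x] is symmetric, it equals [H x *m (cm (G x) v)^T] and can be moved onto [w]; the
    last term is then the one that covariant differentiation of the form subtracts. *)
Lemma deriv_position x v w : M x ->
  'D_v (fun y => bil (H y) y w : R^o) x =
  bil (H x) v w + bil (H x) x (w *m cm (G x) v).
Proof.
move=> Mx; have -> : 'D_v (fun y => bil (H y) y w : R^o) x =
    dmx v (fun y => y *m H y *m w^T) x 0 0 by rewrite mxE.
have di : mxdiff (id : 'rV[R]_n -> 'rV[R]_n) x.
  exact: (elemmx_mxdiff oM (elemmx_id M) Mx).
have dw : mxdiff (fun=> w^T : 'cV[R]_n) x.
  exact: (elemmx_mxdiff oM (elemmx_cst M w^T) Mx).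
have Di : dmx v (id : 'rV[R]_n -> 'rV[R]_n) x = v by rewrite -derive_dmx// derive_id.
rewrite dmx_mul//; last by apply: mxdiff_mul => //; exact: dH.
rewrite (dmx_mul v di (dH Mx)) Di dmx_cst mulmx0 addr0.
rewrite -[dmx v H x]dmx_hess_sym// dmx_hess// trmx_mul sH// /bil.
by rewrite trmx_mul mulmxDl mxDE !mulmxA.
Qed.

Let elem_position w : elem M (fun y => bil (H y) y w).
Proof.
have := elemmx_mul (elemmx_mul (elemmx_id M) eH) (elemmx_cst M w^T).
by move=> /(_ 0 0)/elem_ext; apply.
Qed.

(* For [g = D d phi] the 1-form [g x x] is [d (x . d phi - phi)], i.e. [d] of the
   Legendre dual of [phi], and its [G]-derivative is [g]. *)
Section PositionTrace.
Variable c : R.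
Hypothesis tr_cm : forall y a, M y -> \tr (cm (G y) a) = c * bil (H y) y a.

(** The left-hand side is the covariant derivative of the trace form of the connection, that is,
    minus twice the second Koszul form; [tangent_einstein] takes it in this shape. *)
Lemma deriv_tr_cm x u v : M x ->
  \tr (dmx u (fun y => cm (G y) v) x) - \tr (cm (G x) (v *m cm (G x) u)) =
  c * bil (H x) u v.
Proof.
move=> Mx; have -> : \tr (dmx u (fun y => cm (G y) v) x) =
    'D_u (fun y => \tr (cm (G y) v) : R^o) x.
  rewrite (deriv_sum oM (F := fun i y => cm (G y) v i i) _ _ _ Mx); last first.
    by move=> i; exact: ecm.
  by apply: eq_bigr => i _; rewrite mxE.
rewrite (deriv_ext oM (h := fun y => c * bil (H y) y v) _ Mx); last first.
  by move=> y My; rewrite tr_cm.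
rewrite deriv_scale; last exact: (elem_differentiable oM (elem_position v) Mx).
by rewrite deriv_position// tr_cm// -mulrBr addrK.
Qed.

Lemma koszul2E x v w : (forall y, M y -> 0 < \det (H y)) -> M x ->
  koszul2 g G x v w = - (1 / 2) * c * g x v w.
Proof.
move=> d0 Mx; have k1 y a : M y -> koszul1 g G y a = - (1 / 2) * c * bil (H y) y a.
  by move=> My; rewrite koszul1E// ?d0// tr_cm// mulrA.
rewrite /koszul2 /cov1 (k1 _ _ Mx) cov_cst.
rewrite (deriv_ext oM (h := fun y => - (1 / 2) * c * bil (H y) y w) _ Mx); last first.
  by move=> y My; exact: k1.
rewrite deriv_scale; last exact: (elem_differentiable oM (elem_position w) Mx).
by rewrite deriv_position// -mulrBr addrK gH.
Qed.

End PositionTrace.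
End DualConnection.
End HessianStructure.

(** * The Hessian matrix of a potential and its Codazzi equation *)

Section HessianOfPotential.
Context (R : realType) (m : nat).
Let n := m.+1.
Variables (M : set 'rV[R]_n) (phi : 'rV[R]_n -> R).
Hypotheses (oM : open M) (ephi : elem M phi).
Implicit Types (x u v w : 'rV[R]_n).

Definition hess x : 'M[R]_n := \matrix_(i, j)
  'D_(delta_mx 0 i) (fun y => 'D_(delta_mx 0 j) (phi : _ -> R^o) y : R^o) x.

Lemma elemmx_hess : elemmx M hess.
Proof.
move=> i j; have e := elem_D oM (delta_mx 0 i) (elem_D oM (delta_mx 0 j) ephi).
by apply: (elem_ext e) => x _; rewrite mxE.
Qed.

Lemma derive_row f x v : elem M f -> M x -> 'D_v (f : _ -> R^o) x =
  \sum_i v 0 i * 'D_(delta_mx 0 i) (f : _ -> R^o) x.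
Proof.
move=> ef Mx; have df := elem_differentiable oM ef Mx.
rewrite deriveE// {1}(row_sum_delta v) linear_sum; apply: eq_bigr => i _.
by rewrite linearZ deriveE.
Qed.

Lemma bil_hess x v w : M x ->
  'D_v (fun y => 'D_w (phi : _ -> R^o) y : R^o) x = bil (hess x) v w.
Proof.
move=> Mx; have eD u := elem_D oM u ephi.
have trE j : w^T j 0 = w 0 j by rewrite mxE.
have hessE i j : hess x i j =
  'D_(delta_mx 0 i) (fun y => 'D_(delta_mx 0 j) (phi : _ -> R^o) y : R^o) x.
  by rewrite mxE.
rewrite (derive_row v (eD w) Mx) /bil -mulmxA mxE; apply: eq_bigr => i _.
(* Only an outermost derivative can be expanded by [derive_row]; this swap brings [w] outside, and
   [hE] restores the order afterwards. *)
congr (_ * _); rewrite (elem_derive_comm oM (delta_mx 0 i) w ephi Mx).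
rewrite (derive_row w (eD _) Mx) mxE; apply: eq_bigr => j _.
have hE := elem_derive_comm oM (delta_mx 0 j) (delta_mx 0 i) ephi Mx.
by apply: (etrans (congr1 ( *%R (w 0 j)) hE)); rewrite mulrC -hessE trE.
Qed.

Lemma hess_sym x : M x -> (hess x)^T = hess x.
Proof.
move=> Mx; apply: bil_inj => v w; rewrite (bil_tr (hess x)^T) trmxK.
apply: (etrans (esym (bil_hess w v Mx))); apply: (etrans _ (bil_hess v w Mx)).
exact: (elem_derive_comm oM w v ephi Mx).
Qed.

(** Paired with a basis vector, both sides are third derivatives of [phi], which do not depend on
    the order. *)
Lemma hess_codazzi x u w : M x -> w *m dmx u hess x = u *m dmx w hess x.
Proof.
move=> Mx; have D a b c : bil (dmx a hess x) b c =
    'D_a (fun y => 'D_b (fun t => 'D_c (phi : _ -> R^o) t : R^o) y : R^o) x.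
  rewrite (deriv_ext oM (h := fun y => bil (hess y) b c) _ Mx); last first.
    by move=> y My; exact: bil_hess.
  have -> : 'D_a (fun y => bil (hess y) b c : R^o) x =
    dmx a (fun y => b *m hess y *m c^T) x 0 0 by rewrite mxE.
  have eb := elemmx_cst M b; have ec := elemmx_cst M c^T.
  rewrite (dmx_mul a (elemmx_mxdiff oM (elemmx_mul eb elemmx_hess) Mx)
                     (elemmx_mxdiff oM ec Mx)).
  rewrite (dmx_mul a (elemmx_mxdiff oM eb Mx) (elemmx_mxdiff oM elemmx_hess Mx)).
  by rewrite !dmx_cst mul0mx add0r mulmx0 addr0.
apply/rowP => j; have eD := elem_D oM (delta_mx 0 j) ephi.
have := D u w (delta_mx 0 j); have := D w u (delta_mx 0 j).
move=> D1 D2; have D12 := etrans D1 (etrans (elem_derive_comm oM w u eD Mx) (esym D2)).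
have bE (A : 'M[R]_n) b : bil A b (delta_mx 0 j) = (b *m A) 0 j.
  by rewrite /bil trmx_delta -colE mxE.
exact: (etrans (esym (bE _ _)) (etrans (esym D12) (bE _ _))).
Qed.

End HessianOfPotential.

(** * Connections in a moving frame *)

(* [a *m T z] are the components of [a] in the frame, in which the connection
   form is [om]. *)
Section Gauge.
Context (R : realType) (k : nat).
Let p := k.+1.
Variables (N : set 'rV[R]_p) (oN : open N).
Variables (T T' : 'rV[R]_p -> 'M[R]_p) (om : 'rV[R]_p -> 'rV[R]_p -> 'M[R]_p).
Hypotheses (eT : elemmx N T) (eT' : elemmx N T') (eom : forall a, elemmx N (om^~ a)).
Hypothesis TT' : forall z, N z -> T z *m T' z = 1%:M.
Variable G : connection R k.
Hypothesis cmG : forall z a, N z -> cm (G z) a = (dmx a T z + T z *m om z a) *m T' z.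
Implicit Types (z a b : 'rV[R]_p).

Let T'T z : N z -> T' z *m T z = 1%:M.
Proof. by move=> Nz; apply: mulmx1C; exact: TT'. Qed.

Let md n1 n2 (A : 'rV[R]_p -> 'M[R]_(n1, n2)) z : elemmx N A -> N z -> mxdiff A z.
Proof. exact: elemmx_mxdiff. Qed.

Let key z (A P Q : 'M[R]_p) : N z -> A *m T' z *m ((P + T z *m Q) *m T' z) =
  A *m (T' z *m P *m T' z) + A *m Q *m T' z.
Proof.
move=> Nz; rewrite mulmxDl mulmxDr -!mulmxA; congr (_ + _ *m _).
by rewrite mulmxA T'T// mul1mx.
Qed.

Lemma gauge_elem i j l : elem N (fun z => G z i j l).
Proof.
have e1 := elemmx_add (elemmx_dmx oN (delta_mx 0 i) eT)
                      (elemmx_mul eT (eom (delta_mx 0 i))).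
have := elemmx_mul e1 eT'.
move=> /(_ j l)/elem_ext; apply=> z Nz; rewrite -(cmG (delta_mx 0 i) Nz) mxE.
rewrite (bigD1 i)//= big1 => [|h hi]; first by rewrite addr0 mxE !eqxx mulr1.
by rewrite mxE (negbTE hi) andbF mulr0.
Qed.

Lemma dmx_gauge_inv a z : N z -> dmx a T' z = - (T' z *m dmx a T z *m T' z).
Proof.
move=> Nz; have E : dmx a (fun y => T y *m T' y) z = 0.
  by rewrite -(dmx_cst a 1%:M z); exact: (dmx_ext oN a Nz TT').
move: E; rewrite (dmx_mul a (md eT Nz) (md eT' Nz)).
move/(congr1 (mulmx (T' z))); rewrite mulmx0 mulmxDr mulmxA (mulmxA _ (T z)).
by rewrite T'T// mul1mx => /eqP; rewrite addrC addr_eq0 => /eqP.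
Qed.

(** The second derivatives of [T] commute and the terms mixing derivatives of [T] with [om] are
    symmetric in [a] and [b], so antisymmetrization leaves only the curvature of [om], conjugated by
    [T]. *)
Lemma gauge_curvature a b z : N z -> curvmx G z a b =
  T z *m (dmx a (om^~ b) z - dmx b (om^~ a) z + om z b *m om z a - om z a *m om z b)
  *m T' z.
Proof.
move=> Nz.
have E c d : dmx c (fun y => cm (G y) d) z + cm (G z) d *m cm (G z) c =
    (dmx c (dmx d T) z + (dmx c T z *m om z d + dmx d T z *m om z c)
     + T z *m (dmx c (om^~ d) z + om z d *m om z c)) *m T' z.
  rewrite (dmx_ext oN c Nz (fun y Ny => cmG d Ny)).
  have e1 := elemmx_dmx oN d eT; have e2 := elemmx_mul eT (eom d).
  rewrite (dmx_mul c (md (elemmx_add e1 e2) Nz) (md eT' Nz)).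
  rewrite (dmx_add c (md e1 Nz) (md e2 Nz)) (dmx_mul c (md eT Nz) (md (eom d) Nz)).
  rewrite (dmx_gauge_inv c Nz) (cmG c Nz) (cmG d Nz).
  set A := dmx d T z + _; set P := dmx c T z.
  (* [key] expands the quadratic term; its part containing [P] cancels the derivative of [T']. *)
  rewrite key//.
  rewrite mulmxN addrA subrK -mulmxDl /A; congr (_ *m _).
  rewrite mulmxDl mulmxDr !mulmxA -!addrA; congr (_ + _).
  by congr (_ + _); rewrite [LHS]addrCA.
have sub4 (x y u v : 'M[R]_p) : x - y + u - v = (x + u) - (y + v).
  by rewrite [in RHS]opprD [RHS]addrACA [RHS]addrA.
rewrite /curvmx !sub4 (E a b) (E b a) (dmx_comm oN a b eT Nz) -mulmxBl.
congr (_ *m _); rewrite (addrC (dmx b T z *m _)) mulmxBr.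
by rewrite [in LHS]opprD [LHS]addrACA subrr add0r.
Qed.

(** [K] and [T *m K *m T^T] are the Gram matrices of one metric in the frame and in coordinates:
    being parallel does not depend on the frame. *)
Lemma gauge_metric (K : 'rV[R]_p -> 'M[R]_p) a z : elemmx N K -> N z ->
  dmx a K z = om z a *m K z + K z *m (om z a)^T ->
  dmx a (fun y => T y *m K y *m (T y)^T) z =
  cm (G z) a *m (T z *m K z *m (T z)^T) +
  T z *m K z *m (T z)^T *m (cm (G z) a)^T.
Proof.
move=> eK Nz dK; have eTt := elemmx_tr eT; have eTK := elemmx_mul eT eK.
rewrite (dmx_mul a (md eTK Nz) (md eTt Nz)) (dmx_mul a (md eT Nz) (md eK Nz)).
rewrite dmx_tr dK (cmG a Nz); set P := dmx a T z.
have -> : (P + T z *m om z a) *m T' z *m (T z *m K z *m (T z)^T) =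
    (P + T z *m om z a) *m K z *m (T z)^T.
  by rewrite -!mulmxA; congr (_ *m _); rewrite mulmxA T'T// mul1mx.
have -> : T z *m K z *m (T z)^T *m ((P + T z *m om z a) *m T' z)^T =
    T z *m K z *m (P + T z *m om z a)^T.
  rewrite trmx_mul -!mulmxA; congr (_ *m (_ *m _)).
  by rewrite mulmxA -trmx_mul T'T// trmx1 mul1mx.
have -> : (P + T z *m om z a)^T = P^T + (om z a)^T *m (T z)^T.
  by rewrite [LHS]raddfD /= trmx_mul.
rewrite !mulmxDl !mulmxDr !mulmxDl !mulmxA -!addrA.
by congr (_ + (_ + _)); rewrite addrC.
Qed.

(** An endomorphism that is constant in the frame is parallel once it commutes with the connection
    form; the case needed is multiplication by i. *)
Lemma gauge_conj (j : 'M[R]_p) a z : N z -> om z a *m j = j *m om z a ->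
  dmx a (fun y => T y *m j *m T' y) z =
  cm (G z) a *m (T z *m j *m T' z) - T z *m j *m T' z *m cm (G z) a.
Proof.
move=> Nz jom; have ej := elemmx_cst N j; have eTj := elemmx_mul eT ej.
rewrite (dmx_mul a (md eTj Nz) (md eT' Nz)) (dmx_mul a (md eT Nz) (md ej Nz)).
rewrite dmx_cst mulmx0 addr0 (dmx_gauge_inv a Nz) (cmG a Nz); set P := dmx a T z.
have -> : (P + T z *m om z a) *m T' z *m (T z *m j *m T' z) =
    (P *m j + T z *m om z a *m j) *m T' z.
  by rewrite -mulmxDl -!mulmxA; congr (_ *m _); rewrite mulmxA T'T// mul1mx.
have -> : T z *m j *m T' z *m ((P + T z *m om z a) *m T' z) =
    (T z *m j *m T' z *m P + T z *m j *m om z a) *m T' z.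
  rewrite mulmxA mulmxDr; congr ((_ + _) *m _).
  by rewrite -!mulmxA (mulmxA (T' z)) T'T// mul1mx.
rewrite -mulmxBl -(mulmxA (T z) (om z a)) jom mulmxA opprD addrACA subrr addr0.
by rewrite mulmxN mulmxBl !mulmxA.
Qed.

End Gauge.

(** * Parallel complex structures: integrability and closedness of the fundamental form *)

Section ParallelComplexStructure.
Context (R : realType) (k : nat).
Let p := k.+1.
Variables (N : set 'rV[R]_p) (oN : open N) (G : connection R k).
Variables (Jm H : 'rV[R]_p -> 'M[R]_p) (J : endo R k) (g : bform R k).
Hypotheses (eJ : elemmx N Jm) (eH : elemmx N H).
Hypothesis JE : forall z, N z -> forall a, J z a = a *m Jm z.
Hypothesis gE : forall z, N z -> forall a b, g z a b = bil (H z) a b.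
Hypothesis symG : forall z, N z -> forall a b, b *m cm (G z) a = a *m cm (G z) b.
Hypothesis JJ : forall z, N z -> Jm z *m Jm z = - 1%:M.
Hypothesis dJ : forall z, N z -> forall a,
  dmx a Jm z = cm (G z) a *m Jm z - Jm z *m cm (G z) a.
Hypothesis dH : forall z, N z -> forall a,
  dmx a H z = cm (G z) a *m H z + H z *m (cm (G z) a)^T.
Hypothesis JH : forall z, N z -> Jm z *m H z *m (Jm z)^T = H z.
Hypothesis sH : forall z, N z -> (H z)^T = H z.
Implicit Types (z a b : 'rV[R]_p).

Let deriv_J z v w : N z -> 'D_v (J^~ w) z = w *m dmx v Jm z.
Proof.
move=> Nz; have ew := elemmx_cst N w.
rewrite (deriv_ext oN v Nz (fun y Ny => JE Ny w)).
rewrite (derive_dmx v (elemmx_mxdiff oN (elemmx_mul ew eJ) Nz)).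
rewrite (dmx_mul v (elemmx_mxdiff oN ew Nz) (elemmx_mxdiff oN eJ Nz)).
by rewrite dmx_cst mul0mx add0r.
Qed.

(** For a torsion-free connection, brackets are commutators of covariant derivatives, through which
    a parallel [J] passes; in matrices, [symG] makes the terms coming from [dJ] cancel in pairs. *)
Lemma parallel_nijenhuis z v w : N z -> nijenhuis J z v w = 0.
Proof.
move=> Nz; rewrite /nijenhuis lie_cst /lie !derive_cst !(deriv_J _ _ Nz) sub0r !subr0.
rewrite !(JE Nz) !(dJ Nz) mulNmx opprK !mulmxBr !mulmxBl !mulmxA.
rewrite (symG Nz (v *m Jm z) w) (symG Nz (w *m Jm z) v).
rewrite (symG Nz (w *m Jm z) (v *m Jm z)) (symG Nz w v).
apply/rowP => i; rewrite !mxE; ring.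
Qed.

Let W z := Jm z *m H z.

Let W_skew z : N z -> (W z)^T = - W z.
Proof.
move=> Nz; rewrite /W trmx_mul sH// -[in RHS](JH Nz) !mulmxA JJ//.
by rewrite mulNmx mul1mx mulNmx opprK.
Qed.

(** [W] is parallel as a product of parallel tensors, and for a torsion-free connection the exterior
    derivative is the alternation of the covariant one. *)
Lemma parallel_dform2 z u v w : N z ->
  dform2 (fundamental_form g J) z u v w = 0.
Proof.
move=> Nz; have eW : elemmx N W := elemmx_mul eJ eH.
have bilW y a b : N y -> fundamental_form g J y a b = bil (W y) a b.
  by move=> Ny; rewrite /fundamental_form JE// gE// /bil /W !mulmxA.
have dW a : dmx a W z = cm (G z) a *m W z + W z *m (cm (G z) a)^T.
  rewrite (dmx_mul a (elemmx_mxdiff oN eJ Nz) (elemmx_mxdiff oN eH Nz)).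
  by rewrite dJ// dH// mulmxBl mulmxDr !mulmxA addrA subrK.
have D a b c : 'D_a (fun y => fundamental_form g J y b c : R^o) z =
    bil (W z) (b *m cm (G z) a) c + bil (W z) b (c *m cm (G z) a).
  rewrite (deriv_ext oN a Nz (fun y Ny => bilW y b c Ny)).
  have -> : 'D_a (fun y => bil (W y) b c : R^o) z =
    dmx a (fun y => b *m W y *m c^T) z 0 0 by rewrite mxE.
  have eb := elemmx_cst N b; have ec := elemmx_cst N c^T.
  rewrite (dmx_mul a (elemmx_mxdiff oN (elemmx_mul eb eW) Nz) (elemmx_mxdiff oN ec Nz)).
  rewrite (dmx_mul a (elemmx_mxdiff oN eb Nz) (elemmx_mxdiff oN eW Nz)).
  rewrite !dmx_cst mul0mx add0r mulmx0 addr0 dW /bil trmx_mul mulmxDr mulmxDl.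
  by rewrite [LHS]mxE !mulmxA.
have skew a b : bil (W z) a b = - bil (W z) b a.
  by rewrite bil_tr W_skew// /bil mulmxN mulNmx mxE.
rewrite /dform2 !D (symG Nz v u) (symG Nz w u) (symG Nz w v).
rewrite (skew v) (skew w (v *m _)) (skew u (w *m _)).
ring.
Qed.

End ParallelComplexStructure.

(** * The tangent bundle *)

Section Pullback.
Context (R : realType) (p q : nat).
Implicit Types (M : set 'rV[R]_p) (z a : 'rV[R]_(p + q)).

Lemma elem_lsubmx M (f : 'rV[R]_p -> R) :
  elem M f -> elem [set z : 'rV[R]_(p + q) | M (lsubmx z)] (fun z => f (lsubmx z)).
Proof.
elim=> {f} [c|i|f h _ ef _ eh|f h _ ef _ eh|f _ ef f0|f _ ef f0|f h _ ef fh].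
- exact: elem_cst.
- by apply: (elem_ext (elem_coord _ (lshift q i))) => z _; rewrite mxE.
- exact: elem_plus.
- exact: elem_mult.
- by apply: elem_inv => // z; exact: f0.
- by apply: elem_ln => // z; exact: f0.
- by apply: (elem_ext ef) => z; exact: fh.
Qed.

Lemma elemmx_pull b c M (A : 'rV[R]_p -> 'M[R]_(b, c)) : elemmx M A ->
  elemmx [set z : 'rV[R]_(p + q) | M (lsubmx z)] (fun z => A (lsubmx z)).
Proof. by move=> eA i j; exact: (elem_lsubmx (eA i j)). Qed.

Lemma elemmx_lsubmx (N : set 'rV[R]_(p + q)) : elemmx N lsubmx.
Proof.
move=> i j; apply: (elem_ext (elem_coord _ (lshift q j))) => z _.
by rewrite (ord1 i) mxE.
Qed.

Lemma elemmx_rsubmx (N : set 'rV[R]_(p + q)) : elemmx N rsubmx.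
Proof.
move=> i j; apply: (elem_ext (elem_coord _ (rshift p j))) => z _.
by rewrite (ord1 i) mxE.
Qed.

Lemma dmx_rsubmx a z : dmx a rsubmx z = rsubmx a.
Proof.
apply/matrixP => i j; rewrite (ord1 i) !mxE.
under eq_fun do rewrite mxE.
exact: deriv_coord.
Qed.

Lemma derive_lsubmx (W : normedModType R) (f : 'rV[R]_p -> W) a z :
  'D_a (fun y => f (lsubmx y)) z = 'D_(lsubmx a) f (lsubmx z).
Proof.
have E (h : R) : lsubmx (h *: a + z) = h *: lsubmx a + lsubmx z.
  by rewrite linearD linearZ.
by rewrite /derive /=; under eq_fun do rewrite E.
Qed.

Lemma dmx_pull b c (A : 'rV[R]_p -> 'M[R]_(b, c)) a z :
  dmx a (fun y => A (lsubmx y)) z = dmx (lsubmx a) A (lsubmx z).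
Proof.
apply/matrixP => i j; rewrite !mxE.
exact: (@derive_lsubmx R^o (fun x => A x i j)).
Qed.

Lemma open_lsubmx M : open M -> open [set z : 'rV[R]_(p + q) | M (lsubmx z)].
Proof. by move=> oM; apply: open_comp => // z _; exact: continuous_lsubmx. Qed.

End Pullback.

(** * Complex-linear block matrices and the algebra of the curvature on TM *)

Section ComplexBlocks.
Context (R : realType) (n : nat).
Implicit Types (P Q : 'M[R]_n) (X Y : 'rV[R]_n).

(* The row [(X, Y)] stands for [X + i Y], on which [cblock P Q] acts as [P - i Q]
   and [cblock 0 (- 1)] as multiplication by [i]. *)
Definition cblock P Q : 'M[R]_(n + n) := block_mx P (- Q) Q P.

Lemma cblock_mul P Q P' Q' :
  cblock P Q *m cblock P' Q' = cblock (P *m P' - Q *m Q') (Q *m P' + P *m Q').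
Proof.
rewrite /cblock mulmx_block !mulNmx !mulmxN; congr block_mx.
  by rewrite opprD addrC.
by rewrite addrC.
Qed.

Lemma cblockD P Q P' Q' : cblock P Q + cblock P' Q' = cblock (P + P') (Q + Q').
Proof. by rewrite /cblock add_block_mx opprD. Qed.

Lemma cblockN P Q : - cblock P Q = cblock (- P) (- Q).
Proof. by rewrite /cblock opp_block_mx. Qed.

Lemma row_cblock X Y P Q :
  row_mx X Y *m cblock P Q = row_mx (X *m P + Y *m Q) (Y *m P - X *m Q).
Proof. by rewrite /cblock mul_row_block mulmxN [- _ + _]addrC. Qed.

Lemma cblock_i_comm P Q : cblock P Q *m cblock 0 (- 1%:M) = cblock 0 (- 1%:M) *m cblock P Q.
Proof.
by rewrite !cblock_mul !mulmx0 !mul0mx !mulmxN !mulNmx !mulmx1 !mul1mx !(sub0r, add0r, addr0).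
Qed.

Lemma mul_connection_block (c : 'rV[R]_(n + n)) (E P Q : 'M[R]_n) X Y :
  c *m block_mx 0 E 0 0 + row_mx X Y *m cblock P Q =
  row_mx (X *m P + Y *m Q) (lsubmx c *m E + (Y *m P - X *m Q)).
Proof.
rewrite -{1}(hsubmxK c) mul_row_block !mulmx0 !addr0 row_cblock add_row_mx.
by rewrite add0r.
Qed.

(* [S] is half the connection matrix of a flat torsion-free connection at a point
   and [dS u v] is the derivative of [S v] along [u].  The horizontal and vertical
   parts of the two vectors are [(h, k)] and [(h', k')]. *)
Section CurvatureAlgebra.
Variables (S : {linear 'rV[R]_n -> 'M[R]_n}) (dS : 'rV[R]_n -> 'rV[R]_n -> 'M[R]_n).
Hypothesis S_sym : forall v w : 'rV[R]_n, w *m S v = v *m S w.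
Hypothesis dS_sym : forall u v w : 'rV[R]_n, w *m dS u v = v *m dS u w.
Hypothesis dS_flat : forall u v, dS u v =
  dS v u + (S u *m S v + S u *m S v) - (S v *m S u + S v *m S u).
Implicit Types (h k u v Z : 'rV[R]_n).

(** For the connection with matrix [S + S], the sum [ricD u v + ricA u v + ricA u v] is the
    covariant derivative of the tensor [S] along [u], evaluated at [v]. The two diagonal blocks of
    the curvature share it out as [ricA] and [ricD + ricA]. *)
Definition ricA u v := S v *m S u - S (v *m S u).
Definition ricD u v := dS u v - (S u *m S v + S u *m S v).

(** The vertical component of the torsion in the frame of lifts vanishes: [E] and [E'] stand for
    derivatives of vertical components, and [vcoord_bracket] supplies the hypothesis. *)
Lemma half_bracket (E E' h k h' k' : 'rV[R]_n) :
  E - E' = k *m (S h' + S h') - k' *m (S h + S h) ->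
  E + (k' *m S h - h' *m S k) = E' + (k *m S h' - h *m S k').
Proof.
rewrite !mulmxDr (S_sym h k') (S_sym h' k).
by move=> /rowP F; apply/rowP => i; have := F i; rewrite !(mxDE, mxNE); lra.
Qed.

(** Flatness trades the derivatives of [S] for products, so the real part of the curvature is
    quadratic in [S]. *)
Lemma mul_curvature_re h k h' k' Z :
  Z *m (dS h h' - dS h' h + (S h' *m S h - S k' *m S k) - (S h *m S h' - S k *m S k'))
  = h *m ricA h' Z + k *m ricA k' Z.
Proof.
rewrite /ricA (dS_flat h h') !(mulmxDr, mulmxN) !mulmxA.
rewrite (S_sym h Z) (S_sym k Z) (S_sym h (Z *m S h')) (S_sym k (Z *m S k')).
by apply/rowP => i; rewrite !(mxDE, mxNE); ring.
Qed.

(** The term with [S] applied to a difference arises because the vertical component of a constant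
    vector varies with the point of TM. *)
Lemma mul_curvature_im h k h' k' Z :
  Z *m (dS h k' - dS h' k + S (k *m (S h' + S h') - k' *m (S h + S h))
        + (S k' *m S h + S h' *m S k) - (S k *m S h' + S h *m S k'))
  = h *m (ricD k' Z + ricA k' Z) - k *m (ricD h' Z + ricA h' Z).
Proof.
rewrite /ricA /ricD (dS_flat h k') !mulmxDr (linearB S) !(linearD S).
rewrite (S_sym h k') !(mulmxDr, mulmxN) !mulmxA.
rewrite (dS_sym k' h Z) (dS_sym h' k Z) (S_sym h Z) (S_sym k Z).
rewrite (S_sym (h *m S k') Z) (S_sym (k *m S h') Z).
rewrite (S_sym h (Z *m S k')) (S_sym k (Z *m S h')).
by apply/rowP => i; rewrite !(mxDE, mxNE); ring.
Qed.

(* The Ricci tensor is a trace over the first vector, so the curvature is written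
   as a matrix applied to it. *)
Definition ric_block h k X Y : 'M[R]_(n + n) :=
  block_mx (ricA h X + (ricD k Y + ricA k Y)) (ricA h Y - (ricD k X + ricA k X))
           (ricA k X - (ricD h Y + ricA h Y)) (ricA k Y + (ricD h X + ricA h X)).

Lemma row_curvature h k h' k' X Y :
  row_mx X Y *m cblock
    (dS h h' - dS h' h + (S h' *m S h - S k' *m S k) - (S h *m S h' - S k *m S k'))
    (dS h k' - dS h' k + S (k *m (S h' + S h') - k' *m (S h + S h))
     + (S k' *m S h + S h' *m S k) - (S k *m S h' + S h *m S k'))
  = row_mx h k *m ric_block h' k' X Y.
Proof.
rewrite row_cblock !mul_curvature_re !mul_curvature_im mul_row_block.
congr row_mx; rewrite !(mulmxDr, mulmxN);
  by apply/rowP => i; rewrite !(mxDE, mxNE); ring.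
Qed.

(** Cyclicity of the trace removes the products of two values of [S]; what remains, on each of the
    two parts, is the covariant derivative of the 1-form given by the trace of [S]. *)
Lemma tr_ric_block h k X Y : \tr (ric_block h k X Y) =
  (\tr (dS h X) - (\tr (S (X *m S h)) + \tr (S (X *m S h)))) +
  (\tr (dS k Y) - (\tr (S (Y *m S k)) + \tr (S (Y *m S k)))).
Proof.
rewrite mxtrace_block /ricA /ricD !(mxtraceD, raddfN) /= !(mxtraceD, raddfN) /=.
rewrite (mxtrace_mulC (S h)) (mxtrace_mulC (S k)); ring.
Qed.

End CurvatureAlgebra.

End ComplexBlocks.

(** * Levi-Civita connection, Kähler property and Ricci tensor of the tangent bundle *)

Section TangentBundleKahler.
Context (R : realType) (m : nat).
Let n := m.+1.
Variables (M : set 'rV[R]_n) (H : 'rV[R]_n -> 'M[R]_n) (g : bform R m).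
Variable G : connection R m.
Hypotheses (oM : open M) (eH : elemmx M H).
Hypothesis gH : forall x, M x -> forall v w, g x v w = bil (H x) v w.
Hypothesis sH : forall x, M x -> (H x)^T = H x.
Hypothesis pH : forall x, M x -> forall v, v != 0 -> 0 < bil (H x) v v.
Hypothesis eG : forall i j k, elem M (fun x => G x i j k).
Hypothesis dH : forall x v, M x -> dmx v H x = cm (G x) v *m H x.
Hypothesis symG : forall x v w, M x -> w *m cm (G x) v = v *m cm (G x) w.
Hypothesis flatG : forall x u v, M x ->
  dmx u (fun y => cm (G y) v) x - dmx v (fun y => cm (G y) u) x =
  cm (G x) u *m cm (G x) v - cm (G x) v *m cm (G x) u.
Implicit Types (x u v w : 'rV[R]_n) (z a b c : 'rV[R]_(n + n)).

Definition half_conn : connection R m := fun x i j k => 2^-1 * G x i j k.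
Local Notation S x := (cm (half_conn x)).

Lemma cm_half x v : cm (G x) v = S x v + S x v.
Proof.
apply/matrixP => j k; rewrite !mxE -big_split /=; apply: eq_bigr => i _.
by rewrite -mulrDl /half_conn; congr (_ * _); field.
Qed.

Let halfE x v : S x v = 2^-1 *: cm (G x) v.
Proof.
apply/matrixP => j k; rewrite !mxE mulr_sumr.
by apply: eq_bigr => i _; rewrite /half_conn mulrA.
Qed.

Lemma half_sym x v w : M x -> w *m S x v = v *m S x w.
Proof. by move=> Mx; rewrite !halfE -!scalemxAr symG. Qed.

Let eS v : elemmx M (fun x => S x v).
Proof.
apply: elemmx_cm; last exact: elemmx_cst.
by move=> i j k; apply: elem_mult; [exact: elem_cst|exact: eG].
Qed.

Let md r s (A : 'rV[R]_n -> 'M[R]_(r, s)) x : elemmx M A -> M x -> mxdiff A x.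
Proof. exact: elemmx_mxdiff. Qed.

Let dS u v x : M x -> dmx u (fun y => cm (G y) v) x =
  dmx u (fun y => S y v) x + dmx u (fun y => S y v) x.
Proof.
move=> Mx; rewrite -(dmx_add u (md (eS v) Mx) (md (eS v) Mx)).
by apply: (dmx_ext oM u Mx) => y _; exact: cm_half.
Qed.

Lemma half_flat x u v : M x -> dmx u (fun y => S y v) x = dmx v (fun y => S y u) x +
  (S x u *m S x v + S x u *m S x v) - (S x v *m S x u + S x v *m S x u).
Proof.
move=> Mx; have := flatG u v Mx; rewrite !dS// !cm_half !mulmxDl !mulmxDr.
move: (dmx u _ _) (dmx v _ _) (S x u *m _) (S x v *m _) => A B C E /matrixP ABCE.
by apply/matrixP => i j; have := ABCE i j; rewrite !mxE; lra.
Qed.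

Lemma half_dsym x u v w : M x -> w *m dmx u (fun y => S y v) x = v *m dmx u (fun y => S y w) x.
Proof.
move=> Mx; have dE s t : dmx u (fun y => s *m S y t) x = s *m dmx u (fun y => S y t) x.
  rewrite (dmx_mul u (md (elemmx_cst M s) Mx) (md (eS t) Mx)).
  by rewrite dmx_cst mul0mx add0r.
rewrite -!dE; apply: (dmx_ext oM u Mx) => y My; exact: half_sym.
Qed.

Let N : set 'rV[R]_(n + n) := tangent_bundle M.

Let oN : open N := open_lsubmx oM.

(** [vpart] with the arguments of the connection exchanged, which torsion-freeness permits. In this
    order it is [a] multiplied by a matrix that depends on [z] alone, see [mul_to_lifts]. *)
Definition vcoord z a := rsubmx a + lsubmx a *m cm (G (lsubmx z)) (rsubmx z).

Lemma vpart_vcoord z a : N z -> vpart G z a = vcoord z a.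
Proof. by move=> Nz; rewrite /vpart chris_cm symG. Qed.

Let Gy z := cm (G (lsubmx z)) (rsubmx z).

Definition to_lifts z : 'M[R]_(n + n) := block_mx 1%:M (Gy z) 0 1%:M.
Definition of_lifts z : 'M[R]_(n + n) := block_mx 1%:M (- Gy z) 0 1%:M.

Lemma mul_to_lifts z a : a *m to_lifts z = row_mx (lsubmx a) (vcoord z a).
Proof.
by rewrite -{1}(hsubmxK a) mul_row_block !mulmx1 mulmx0 addr0 [_ + rsubmx a]addrC.
Qed.

Lemma to_of_lifts z : to_lifts z *m of_lifts z = 1%:M.
Proof.
rewrite mulmx_block !mulmx0 !mul0mx !mulmx1 !mul1mx !addr0 add0r addNr.
by rewrite -scalar_mx_block.
Qed.

Lemma elemmx_Gy : elemmx N Gy.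
Proof.
apply: elemmx_cm; last exact: elemmx_rsubmx.
by move=> i j k; exact: (elem_lsubmx n (eG i j k)).
Qed.

Let eT : elemmx N to_lifts.
Proof. by apply: elemmx_block; try exact: elemmx_cst; exact: elemmx_Gy. Qed.

Let eT' : elemmx N of_lifts.
Proof.
by apply: elemmx_block; try exact: elemmx_cst; apply: elemmx_opp; exact: elemmx_Gy.
Qed.

Let evc a : elemmx N (vcoord^~ a).
Proof.
apply: elemmx_add; first exact: elemmx_cst.
by apply: elemmx_mul; [exact: elemmx_cst|exact: elemmx_Gy].
Qed.

(* In flat coordinates of [G] the Levi-Civita connection of the metric on [TM] is
   the complex-bilinear extension of that of [g], whose difference with [G] is
   [- S = - 1/2 cm G].  In the frame of lifts of constant fields, where [G] itself
   contributes [cm G] in horizontal directions, this gives [S_h - i S_k]. *)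
Definition lift_conn z a : 'M[R]_(n + n) :=
  cblock (S (lsubmx z) (lsubmx a)) (S (lsubmx z) (vcoord z a)).

Let eSv (V : 'rV[R]_(n + n) -> 'rV[R]_n) : elemmx N V ->
  elemmx N (fun z => S (lsubmx z) (V z)).
Proof.
move=> eV; apply: elemmx_cm => // i j k; apply: elem_mult; first exact: elem_cst.
exact: (elem_lsubmx n (eG i j k)).
Qed.

Let eom a : elemmx N (lift_conn^~ a).
Proof.
have e1 := eSv (elemmx_cst N (lsubmx a)); have e2 := eSv (evc a).
by apply: elemmx_block => //; exact: elemmx_opp.
Qed.

Let mdN r s (A : 'rV[R]_(n + n) -> 'M[R]_(r, s)) z : elemmx N A -> N z -> mxdiff A z.
Proof. exact: elemmx_mxdiff. Qed.

Lemma dmx_cm_pull (K : 'rV[R]_n -> 'I_n -> 'I_n -> 'I_n -> R)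
    (V : 'rV[R]_(n + n) -> 'rV[R]_n) a z :
  (forall i j k, elem M (fun x => K x i j k)) -> elemmx N V -> N z ->
  dmx a (fun y => cm (K (lsubmx y)) (V y)) z =
  dmx (lsubmx a) (fun x => cm (K x) (V z)) (lsubmx z) + cm (K (lsubmx z)) (dmx a V z).
Proof.
move=> eK eV Nz.
have dK i j k : differentiable (fun y => K (lsubmx y) i j k : R^o) z.
  exact: (elem_differentiable oN (elem_lsubmx n (eK i j k)) Nz).
have dK0 i j k : differentiable (fun y => K y i j k : R^o) (lsubmx z).
  exact: (elem_differentiable oM (eK i j k) Nz).
rewrite (dmx_cm a dK (mdN eV Nz)); congr (_ + _).
rewrite (dmx_cm _ dK0 (md (elemmx_cst M (V z)) Nz)) dmx_cst linear0 addr0.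
apply/matrixP => j k; rewrite [LHS]mxE [RHS]mxE; apply: eq_bigr => i _.
congr (_ * _); exact: (@derive_lsubmx _ _ _ R^o (fun x => K x i j k)).
Qed.

Let dGy a z : N z -> dmx a Gy z =
  dmx (lsubmx a) (fun x => cm (G x) (rsubmx z)) (lsubmx z) + cm (G (lsubmx z)) (rsubmx a).
Proof.
by move=> Nz; rewrite (dmx_cm_pull a eG (elemmx_rsubmx N) Nz) dmx_rsubmx.
Qed.

Lemma dmx_vcoord a b z : N z -> dmx b (vcoord^~ a) z = lsubmx a *m dmx b Gy z.
Proof.
move=> Nz; have e1 := elemmx_cst N (lsubmx a); have e2 := elemmx_mul e1 elemmx_Gy.
rewrite (dmx_add b (mdN (elemmx_cst N (rsubmx a)) Nz) (mdN e2 Nz)) dmx_cst add0r.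
rewrite (dmx_mul b (mdN e1 Nz) (mdN elemmx_Gy Nz)).
by rewrite dmx_cst mul0mx add0r.
Qed.

Lemma dmx_cm_sym x u v w : M x ->
  w *m dmx u (fun y => cm (G y) v) x = v *m dmx u (fun y => cm (G y) w) x.
Proof. by move=> Mx; rewrite (dS u v Mx) (dS u w Mx) !mulmxDr (half_dsym u v w Mx). Qed.

(** The structure equation of the vertical coframe. Its purely horizontal term would be the
    curvature of [G] applied to the fibre coordinate, and [flatG] makes it vanish. *)
Lemma vcoord_bracket a b z : N z ->
  lsubmx b *m dmx a Gy z - lsubmx a *m dmx b Gy z =
  vcoord z a *m cm (G (lsubmx z)) (lsubmx b) - vcoord z b *m cm (G (lsubmx z)) (lsubmx a).
Proof.
move=> Nz; rewrite !dGy// !mulmxDr.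
rewrite (dmx_cm_sym _ (rsubmx z) (lsubmx b) Nz) (dmx_cm_sym _ (rsubmx z) (lsubmx a) Nz).
have := congr1 (mulmx (rsubmx z)) (flatG (lsubmx a) (lsubmx b) Nz).
rewrite !mulmxBr !mulmxA /vcoord !mulmxDl.
rewrite (symG (rsubmx z) (lsubmx a) Nz) (symG (rsubmx z) (lsubmx b) Nz).
rewrite (symG (rsubmx b) (lsubmx a) Nz) (symG (rsubmx a) (lsubmx b) Nz).
move=> /rowP F; apply/rowP => i; have := F i.
by rewrite !(mxDE, mxNE); lra.
Qed.

Lemma dmx_to_lifts a z : dmx a to_lifts z = block_mx 0 (dmx a Gy z) 0 0.
Proof. by rewrite dmx_block !dmx_cst. Qed.

Lemma lift_connP z : linear (lift_conn z).
Proof.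
move=> c a b; have vP : vcoord z (c *: a + b) = c *: vcoord z a + vcoord z b.
  rewrite /vcoord !linearP mulmxDl -scalemxAl scalerDr -!addrA.
  by congr (_ + _); rewrite addrCA.
rewrite /lift_conn vP !linearP /cblock scale_block_mx add_block_mx.
by rewrite scalerN opprD.
Qed.

(** [lift_conn] transported from the frame of lifts to coordinates, in the form that the gauge
    lemmas expect. *)
Definition tangent_lc : connection R (m + n) := fun z i j k =>
  ((dmx (delta_mx 0 i) to_lifts z + to_lifts z *m lift_conn z (delta_mx 0 i))
   *m of_lifts z) j k.

Lemma cm_tangent_lc z a : N z -> cm (tangent_lc z) a =
  (dmx a to_lifts z + to_lifts z *m lift_conn z a) *m of_lifts z.
Proof.
move=> Nz; apply: (cm_of_linear (L := fun a =>
  (dmx a to_lifts z + to_lifts z *m lift_conn z a) *m of_lifts z)).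
move=> c b d; rewrite (dmx_dirP (mdN eT Nz)) lift_connP mulmxDr -scalemxAr.
by rewrite addrACA -scalerDr mulmxDl -scalemxAl.
Qed.

Lemma tangent_lc_sym z a b : N z -> b *m cm (tangent_lc z) a = a *m cm (tangent_lc z) b.
Proof.
move=> Nz; rewrite (cm_tangent_lc a Nz) (cm_tangent_lc b Nz) !mulmxA; congr (_ *m _).
rewrite !mulmxDr !mulmxA !mul_to_lifts !dmx_to_lifts /lift_conn.
have Mx : M (lsubmx z) := Nz.
apply: (etrans (mul_connection_block b (dmx a Gy z) _ _ _ _)).
apply: (etrans _ (esym (mul_connection_block a (dmx b Gy z) _ _ _ _))).
rewrite (half_sym (lsubmx a) (lsubmx b) Mx) (half_sym (vcoord z a) (vcoord z b) Mx).
congr row_mx; apply: half_bracket; first by move=> v w; exact: half_sym.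
by rewrite -!cm_half; exact: vcoord_bracket.
Qed.

Lemma dmx_lift_conn a b z : N z -> dmx a (lift_conn^~ b) z =
  cblock (dmx (lsubmx a) (fun y => S y (lsubmx b)) (lsubmx z))
         (dmx (lsubmx a) (fun y => S y (vcoord z b)) (lsubmx z)
          + S (lsubmx z) (lsubmx b *m dmx a Gy z)).
Proof.
move=> Nz; have eh i j k : elem M (fun x => 2^-1 * G x i j k).
  by apply: elem_mult; [exact: elem_cst|exact: eG].
rewrite dmx_block (dmx_opp a (mdN (eSv (evc b)) Nz)).
rewrite (dmx_cm_pull a eh (elemmx_cst N (lsubmx b)) Nz) dmx_cst linear0 addr0.
by rewrite (dmx_cm_pull a eh (evc b) Nz) dmx_vcoord.
Qed.

Lemma lift_curvature z a b (X Y : 'rV[R]_n) : N z ->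
  row_mx X Y *m (dmx a (lift_conn^~ b) z - dmx b (lift_conn^~ a) z
    + lift_conn z b *m lift_conn z a - lift_conn z a *m lift_conn z b) =
  a *m to_lifts z *m
  ric_block (S (lsubmx z)) (fun u v => dmx u (fun y => S y v) (lsubmx z))
    (lsubmx b) (vcoord z b) X Y.
Proof.
move=> Nz; have Mx : M (lsubmx z) := Nz.
rewrite mul_to_lifts -row_curvature; first last.
- by move=> u v; exact: half_flat.
- by move=> u v w; exact: half_dsym.
- by move=> v w; exact: half_sym.
congr (_ *m _); rewrite (dmx_lift_conn a b Nz) (dmx_lift_conn b a Nz) /lift_conn.
rewrite !cblock_mul !cblockN !cblockD.
rewrite -!cm_half -(vcoord_bracket a b Nz).
congr cblock; congr (_ + _ - _).
transitivity (dmx (lsubmx a) (fun y => S y (vcoord z b)) (lsubmx z)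
    - dmx (lsubmx b) (fun y => S y (vcoord z a)) (lsubmx z)
    + (S (lsubmx z) (lsubmx b *m dmx a Gy z) - S (lsubmx z) (lsubmx a *m dmx b Gy z))).
  by rewrite opprD addrACA.
by congr (_ + _); rewrite -linearB.
Qed.

Lemma elem_tangent_lc i j k : elem N (fun z => tangent_lc z i j k).
Proof.
exact: (gauge_elem oN eT eT' eom (fun z a => @cm_tangent_lc z a)).
Qed.

Lemma tangent_lc_curvmx z a b : N z -> curvmx tangent_lc z a b =
  to_lifts z *m (dmx a (lift_conn^~ b) z - dmx b (lift_conn^~ a) z
    + lift_conn z b *m lift_conn z a - lift_conn z a *m lift_conn z b) *m of_lifts z.
Proof.
exact: (gauge_curvature oN eT eT' eom (fun z _ => to_of_lifts z)
  (fun z a => @cm_tangent_lc z a)).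
Qed.

(** By [lift_curvature] the curvature, as a function of its first argument, is [ric_block]
    conjugated by the change of frame, which leaves the trace alone. *)
Lemma tangent_ricci z b c : N z -> ricci tangent_lc z b c =
  \tr (ric_block (S (lsubmx z)) (fun u v => dmx u (fun y => S y v) (lsubmx z))
    (lsubmx b) (vcoord z b) (lsubmx c) (vcoord z c)).
Proof.
move=> Nz; rewrite /ricci; set F := ric_block _ _ _ _ _ _.
transitivity (\tr (to_lifts z *m F *m of_lifts z)).
  apply: eq_bigr => i _.
  rewrite (curvatureE oN _ _ _ elem_tangent_lc Nz) (tangent_lc_curvmx _ b Nz).
  rewrite !mulmxA mul_to_lifts (lift_curvature _ b _ _ Nz) -/F -!mulmxA -rowE mxE.
  by [].
by rewrite mxtrace_mulC mulmxA (mulmx1C (to_of_lifts z)) mul1mx.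
Qed.

Let K z : 'M[R]_(n + n) := block_mx (H (lsubmx z)) 0 0 (H (lsubmx z)).

Let Ht z := to_lifts z *m K z *m (to_lifts z)^T.

Let eK : elemmx N K.
Proof.
by apply: elemmx_block; try exact: elemmx_cst; exact: (elemmx_pull n eH).
Qed.

Lemma bil_tangent z a b :
  bil (Ht z) a b = bil (H (lsubmx z)) (lsubmx a) (lsubmx b)
                   + bil (H (lsubmx z)) (vcoord z a) (vcoord z b).
Proof.
by rewrite bil_mul !mul_to_lifts bil_block.
Qed.

Lemma Tmetric_bil z : N z -> forall a b, Tmetric g G z a b = bil (Ht z) a b.
Proof. by move=> Nz a b; rewrite bil_tangent /Tmetric !gH// !vpart_vcoord. Qed.

Lemma half_hess_sym x v : M x -> H x *m (S x v)^T = S x v *m H x.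
Proof.
move=> Mx; have E : (cm (G x) v *m H x)^T = cm (G x) v *m H x.
  by rewrite -dH// -dmx_tr; apply: (dmx_ext oM).
by rewrite halfE linearZ /= -scalemxAr -scalemxAl -E trmx_mul sH.
Qed.

(** The diagonal blocks of the right-hand side add up to twice [S *m H], which is the derivative of
    [H] by [dH]; the off-diagonal ones cancel because [S *m H] is symmetric. *)
Let dK a z : N z -> dmx a K z = lift_conn z a *m K z + K z *m (lift_conn z a)^T.
Proof.
move=> Nz; have Mx : M (lsubmx z) := Nz.
rewrite dmx_block !dmx_cst (dmx_pull H a z) (dH _ Mx) cm_half mulmxDl.
rewrite /lift_conn /cblock tr_block_mx !mulmx_block !mulmx0 !mul0mx !addr0 !add0r.
rewrite add_block_mx [(- _)^T]linearN /= mulmxN mulNmx !(half_hess_sym _ Mx).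
by rewrite subrr addNr.
Qed.

Let jb : 'M[R]_(n + n) := cblock 0 (- 1%:M).
Let Jm z := to_lifts z *m jb *m of_lifts z.

Let jj : jb *m jb = - 1%:M.
Proof.
rewrite /jb cblock_mul !mulmx0 !mul0mx mulmxN mulmx1 opprK sub0r addr0.
by rewrite /cblock oppr0 (scalar_mx_block n n (1 : R)) opp_block_mx !oppr0.
Qed.

Lemma TJ_mul z : N z -> forall a, TJ G z a = a *m Jm z.
Proof.
move=> Nz a; rewrite /TJ /hlift /vlift vpart_vcoord// /hpart chris_cm symG//.
rewrite /Jm !mulmxA mul_to_lifts /jb row_cblock !mulmx0 !mulmxN !mulmx1 !add0r opprK.
rewrite /of_lifts mul_row_block !mulmx1 mulmx0 addr0 mulmxN mulNmx opprK.
by rewrite opp_row_mx opprK add_row_mx add0r [in RHS]addrC.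
Qed.

Let JJ z : Jm z *m Jm z = - 1%:M.
Proof.
rewrite /Jm -!mulmxA (mulmxA (of_lifts z)) (mulmx1C (to_of_lifts z)) mul1mx.
by rewrite (mulmxA jb) jj mulNmx mul1mx mulmxN to_of_lifts.
Qed.

Let JH z : N z -> Jm z *m Ht z *m (Jm z)^T = Ht z.
Proof.
move=> Nz; have jK : jb *m K z *m jb^T = K z.
  rewrite /jb /cblock /K opprK tr_block_mx !mulmx_block.
  rewrite !trmx0 raddfN /= trmx1 !mulNmx !mulmxN !mul0mx !mulmx0 !mul1mx !mulmx1.
  by rewrite ?(oppr0, addr0, add0r, opprK, mul0mx, mulmx0, mulmx1).
rewrite /Jm /Ht !trmx_mul -!mulmxA (mulmxA (of_lifts z) (to_lifts z)).
rewrite (mulmx1C (to_of_lifts z)) mul1mx (mulmxA (to_lifts z)^T (of_lifts z)^T).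
by rewrite -(trmx_mul (of_lifts z) (to_lifts z)) (mulmx1C (to_of_lifts z)) trmx1 mul1mx
  -[in RHS]jK !mulmxA.
Qed.

Let sHt z : N z -> (Ht z)^T = Ht z.
Proof.
move=> Nz; rewrite /Ht !trmx_mul trmxK mulmxA; congr (_ *m _ *m _).
by rewrite /K tr_block_mx !trmx0 sH.
Qed.

Let pHt z : N z -> forall a, a != 0 -> 0 < bil (Ht z) a a.
Proof.
move=> Nz a a0; have Mx : M (lsubmx z) := Nz.
have ge0 v : 0 <= bil (H (lsubmx z)) v v.
  have [->|/(pH Mx)/ltW//] := eqVneq v 0.
  by rewrite /bil mul0mx mul0mx mxE.
rewrite bil_tangent; have [h0|h0] := eqVneq (lsubmx a) 0.
  apply: ltr_wpDl => //; apply: pH => //; apply: contraNneq a0 => v0.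
  rewrite -(hsubmxK a); move: v0; rewrite /vcoord h0 mul0mx addr0 => ->.
  by rewrite row_mx0.
by apply: ltr_pwDl => //; exact: pH.
Qed.

Let eHt : elemmx N Ht.
Proof. by apply: elemmx_mul; [exact: elemmx_mul|exact: elemmx_tr]. Qed.

Let dHt z a : N z -> dmx a Ht z =
  cm (tangent_lc z) a *m Ht z + Ht z *m (cm (tangent_lc z) a)^T.
Proof.
move=> Nz; exact: (gauge_metric oN eT (fun z _ => to_of_lifts z)
  (fun z a => @cm_tangent_lc z a) eK Nz (dK a Nz)).
Qed.

Let eJm : elemmx N Jm.
Proof. by apply: elemmx_mul => //; apply: elemmx_mul => //; exact: elemmx_cst. Qed.

Let dJm z a : N z -> dmx a Jm z =
  cm (tangent_lc z) a *m Jm z - Jm z *m cm (tangent_lc z) a.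
Proof.
move=> Nz.
have jom : lift_conn z a *m jb = jb *m lift_conn z a by exact: cblock_i_comm.
exact: (gauge_conj oN eT eT' (fun z _ => to_of_lifts z)
  (fun z a => @cm_tangent_lc z a) Nz jom).
Qed.

Lemma tangent_riemannian : riemannian N (Tmetric g G).
Proof. exact: (riemannianP oN eHt Tmetric_bil sHt pHt). Qed.

Lemma tangent_kahler : kahler N (Tmetric g G) (TJ G).
Proof.
split; first exact: tangent_riemannian.
- split.
  + move=> a; apply: (elemmx_smooth oN).
    apply: (elemmx_ext (elemmx_mul (elemmx_cst N a) eJm)) => z Nz.
    by rewrite TJ_mul.
  + by move=> z Nz c a b; rewrite !TJ_mul// mulmxDl scalemxAl.
  + by move=> z Nz a; rewrite !TJ_mul// -mulmxA JJ mulmxN mulmx1.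
- move=> z Nz a b; rewrite !TJ_mul// !Tmetric_bil// -bil_mul JH//.
- move=> z Nz a b; apply: (parallel_nijenhuis oN eJm TJ_mul (G := tangent_lc)) Nz.
    by move=> y Ny c d; exact: tangent_lc_sym.
  by move=> y Ny c; exact: dJm.
- move=> z Nz a b c.
  apply: (parallel_dform2 oN eJm eHt TJ_mul Tmetric_bil (G := tangent_lc)) Nz => y Ny.
  + by move=> d e; exact: tangent_lc_sym.
  + exact: JJ.
  + by move=> d; exact: dJm.
  + by move=> d; exact: dHt.
  + exact: JH.
  + exact: sHt.
Qed.

Lemma tangent_levi_civita : levi_civita N (Tmetric g G) tangent_lc.
Proof.
split.
- by move=> i j k; apply: (elem_smooth oN); exact: elem_tangent_lc.
- by move=> z Nz a b; rewrite torsionE tangent_lc_sym// subrr.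
- by apply/(dual_connectionP oN _ _ eHt Tmetric_bil) => z Nz a; exact: dHt.
Qed.

(** Putting [S + S] for the connection matrix doubles the derivative term of the hypothesis and
    quadruples the quadratic one. Half of it is thus exactly one summand of [tr_ric_block], whence
    [lam / 2]. *)
Lemma tangent_einstein lam :
  (forall x u v, M x -> \tr (dmx u (fun y => cm (G y) v) x)
     - \tr (cm (G x) (v *m cm (G x) u)) = lam * bil (H x) u v) ->
  einstein N (Tmetric g G).
Proof.
move=> ein; exists tangent_lc; first exact: tangent_levi_civita.
suff F z a b : N z -> ricci tangent_lc z a b = lam / 2 * Tmetric g G z a b.
  by exists (lam / 2) => z Nz a b; exact: F.
move=> Nz; rewrite tangent_ricci// tr_ric_block.
rewrite Tmetric_bil// bil_tangent; have Mx : M (lsubmx z) := Nz.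
have E u v : \tr (dmx u (fun y => S y v) (lsubmx z))
    - (\tr (S (lsubmx z) (v *m S (lsubmx z) u)) + \tr (S (lsubmx z) (v *m S (lsubmx z) u)))
    = lam / 2 * bil (H (lsubmx z)) u v.
  have := ein _ u v Mx; rewrite dS// !cm_half mulmxDr linearD !mxtraceD.
  by move=> e; rewrite -mulrA [2^-1 * _]mulrC mulrA -e; field.
by rewrite !E mulrDr.
Qed.

End TangentBundleKahler.

(** * The statistical model *)

Section TwoByTwo.
Context (R : realType).
Implicit Types (A B C P X Y : 'M[R]_2).

Lemma sum_ord2 (V : nmodType) (F : 'I_2 -> V) : \sum_i F i = F 0 + F 1.
Proof.
rewrite !big_ord_recl big_ord0 addr0; congr (F _ + F _); exact/val_inj.
Qed.

Lemma mul_mx2 n p (A : 'M[R]_(n, 2)) (B : 'M[R]_(2, p)) i j :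
  (A *m B) i j = A i 0 * B 0 j + A i 1 * B 1 j.
Proof. by rewrite mxE sum_ord2. Qed.

Lemma mxtrace2 A : \tr A = A 0 0 + A 1 1.
Proof. exact: sum_ord2. Qed.

Lemma det2 A : \det A = A 0 0 * A 1 1 - A 0 1 * A 1 0.
Proof.
rewrite (expand_det_row _ 0) sum_ord2 /cofactor !det_mx11 !mxE /=.
have -> : lift 0 0 = 1 :> 'I_2 by apply/val_inj.
have -> : lift 1 0 = 0 :> 'I_2 by apply/val_inj.
by rewrite expr0 expr1; ring.
Qed.

Lemma matrix2P A B : A 0 0 = B 0 0 -> A 0 1 = B 0 1 -> A 1 0 = B 1 0 ->
  A 1 1 = B 1 1 -> A = B.
Proof.
move=> e1 e2 e3 e4; apply/matrixP => i j.
by case: i => [[|[|//]] hi]; case: j => [[|[|//]] hj];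
  [move: e1|move: e2|move: e3|move: e4];
  congr (_ = _); congr fun_of_matrix; apply/val_inj.
Qed.

Lemma sym2 A : A^T = A -> A 1 0 = A 0 1.
Proof. by move=> /matrixP/(_ 0 1); rewrite mxE. Qed.

Lemma invmx2 A : A^T = A -> \det A != 0 ->
  [/\ invmx A 0 0 = A 1 1 / \det A, invmx A 0 1 = - A 0 1 / \det A,
      invmx A 1 0 = - A 0 1 / \det A & invmx A 1 1 = A 0 0 / \det A].
Proof.
move=> sA d0; have s := sym2 sA.
have uA : A \in unitmx by rewrite unitmxE unitfE.
(* In ['I_2], [1 - i] is the other index, so [V] is the adjugate divided by the determinant. *)
pose V : 'M[R]_2 := \matrix_(i, j)
  ((if i == j then A (1 - i) (1 - i) else - A 0 1) / \det A).
have AV : A *m V = 1%:M.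
  move: d0; rewrite det2 s => d0.
  apply: matrix2P; rewrite mul_mx2 !mxE /= ?subr0 ?subrr det2 s;
    move: (A 0 0) (A 0 1) (A 1 1) d0 => x y t d0; by field.
have -> : invmx A = V by rewrite -[LHS]mulmx1 -AV mulKmx.
by rewrite !mxE /= subr0 subrr.
Qed.

(** Polar form of [\det] on symmetric matrices, with [polar_det X X = 2 * \det X]; [polar_det A X]
    is the derivative of [\det] at [A] along [X]. *)
Definition polar_det X Y := X 0 0 * Y 1 1 + X 1 1 * Y 0 0 - 2 * X 0 1 * Y 0 1.

(** Both sides are minus the second derivative of [ln \det] at [A] along [X] and [Y]. *)
Lemma tr_inv2 A X Y : A^T = A -> X^T = X -> Y^T = Y -> \det A != 0 ->
  \tr (invmx A *m X *m (invmx A *m Y)) =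
  polar_det A X * polar_det A Y / \det A ^+ 2 - polar_det X Y / \det A.
Proof.
move=> sA sX sY d0; have [e1 e2 e3 e4] := invmx2 sA d0.
rewrite mxtrace2 !mul_mx2 e1 e2 e3 e4 (sym2 sX) (sym2 sY) /polar_det.
move: d0; rewrite det2 (sym2 sA).
move: (A 0 0) (A 0 1) (A 1 1) (X 0 0) (X 0 1) (X 1 1) (Y 0 0) (Y 0 1) (Y 1 1).
by move=> a b c x1 x2 x3 y1 y2 y3 d0; field.
Qed.

Lemma tr_square_gt0 P X : P^T = P -> X^T = X -> 0 < P 0 0 -> 0 < \det P -> X != 0 ->
  0 < \tr (P *m X *m (P *m X)).
Proof.
move=> sP sX p0; rewrite det2 mxtrace2 !mul_mx2 (sym2 sP) (sym2 sX) => d0 X0.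
have : ~~ [&& X 0 0 == 0, X 0 1 == 0 & X 1 1 == 0].
  apply: contraNN X0 => /and3P[/eqP x0 /eqP x1 /eqP x2].
  by apply/eqP/matrix2P; rewrite ?(sym2 sX) !mxE.
move: (P 0 0) (P 0 1) (P 1 1) p0 d0 => p r s p0.
move: (X 0 0) (X 0 1) (X 1 1) => x y w.
set d := p * s - r * r => d0 xyw; rewrite -(pmulr_rgt0 _ (exprn_gt0 2 p0)).
(* With P = L L^T, the trace is the squared norm of L^T X L. *)
have -> : p ^+ 2 * ((p * x + r * y) * (p * x + r * y) + (p * y + r * w) * (r * x + s * y)
    + ((r * x + s * y) * (p * y + r * w) + (r * y + s * w) * (r * y + s * w))) =
  (p ^+ 2 * x + 2 * p * r * y + r ^+ 2 * w) ^+ 2 + 2 * d * (p * y + r * w) ^+ 2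
  + d ^+ 2 * w ^+ 2 by rewrite /d; ring.
have n1 := sqr_ge0 (p ^+ 2 * x + 2 * p * r * y + r ^+ 2 * w).
have n2 : 0 <= 2 * d * (p * y + r * w) ^+ 2 by rewrite mulr_ge0 ?sqr_ge0// mulr_ge0// ltW.
have n3 : 0 <= d ^+ 2 * w ^+ 2 by rewrite mulr_ge0// sqr_ge0.
have sq (t : R) : t != 0 -> 0 < t ^+ 2 by move=> t0; rewrite exprn_even_gt0.
have pn0 : p != 0 by rewrite gt_eqF.
have [w0|w0] := eqVneq w 0; last first.
  apply: ltr_wpDl; first exact: (addr_ge0 n1 n2).
  by apply: mulr_gt0; apply: sq => //; rewrite gt_eqF.
have [y0|y0] := eqVneq y 0; last first.
  apply: ltr_pwDl => //; apply: ltr_wpDl => //.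
  apply: mulr_gt0; first exact: mulr_gt0.
  by apply: sq; rewrite w0 mulr0 addr0 mulf_neq0.
apply: ltr_pwDl => //; apply: ltr_pwDl => //.
rewrite w0 y0 !mulr0 !addr0; apply: sq; rewrite mulf_neq0 ?expf_neq0//.
by move: xyw; rewrite w0 y0 eqxx !andbT.
Qed.

(** With q = det A, P the Gram matrix of [polar_det] on [A0], [A1], and p = (x, y) P, [tr_inv2]
    gives h = 1/2 (p^T p / q^2 - P / q). The q^-4 terms of its determinant cancel by rank one, and p
    adj(P) p^T = 2 q det P reduces the q^-3 term to q^-2: the sum is 1/4 (1 - 2) det P / q^2. *)
Lemma det_inv_gram A0 A1 x y : A0^T = A0 -> A1^T = A1 ->
  let A := x *: A0 + y *: A1 in
  let h X Y := 1 / 2 * \tr (invmx A *m X *m (invmx A *m Y)) in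
  \det A != 0 ->
  h A0 A0 * h A1 A1 - h A0 A1 * h A1 A0 =
  - (polar_det A0 A0 * polar_det A1 A1 - polar_det A0 A1 ^+ 2) / 4 / \det A ^+ 2.
Proof.
move=> s0 s1 A h d0; have sA : A^T = A by rewrite /A linearD !linearZ /= s0 s1.
have E i j : A i j = x * A0 i j + y * A1 i j by rewrite !mxE.
rewrite /h !tr_inv2// /polar_det; move: d0; rewrite det2 (sym2 sA) !E.
move: (A0 0 0) (A0 0 1) (A0 1 1) (A1 0 0) (A1 0 1) (A1 1 1) => a b c a' b' c' d0.
by field.
Qed.

End TwoByTwo.

(** * The Fisher metric of the model and the determinant of its matrix *)

Section StatisticalModel.
Context (R : realType).
Variables (U : set 'rV[R]_2) (rho : {linear 'rV[R]_2 -> 'M[R]_2}).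
Hypotheses (oU : open U) (rho_inj : injective rho) (rho_sym : forall xi, S2 (rho xi)).
Hypothesis rho_pos : rho @` U `<=` S2_pos.
Implicit Types (z v w : 'rV[R]_(2 + 2)).

Let M : set 'rV[R]_(2 + 2) := model_domain U.
Let A z := rho (rsubmx z).
Let mu z := lsubmx z *m invmx (A z).

Lemma open_model_domain : open M.
Proof. by apply: open_comp => // z _; exact: continuous_rsubmx. Qed.

Let oM := open_model_domain.

Let posA z : M z -> S2_pos (A z).
Proof. by move=> Mz; apply: rho_pos; exists (rsubmx z). Qed.

Let symA z : (A z)^T = A z := rho_sym (rsubmx z).

Let uA z : M z -> A z \in unitmx.
Proof. by move=> Mz; apply: S2_pos_unit; exact: posA. Qed.

Let dA z : M z -> 0 < \det (A z).
Proof. by move=> Mz; apply: S2_pos_det; exact: posA. Qed.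

Let symV z : (invmx (A z))^T = invmx (A z).
Proof. by rewrite trmx_inv symA. Qed.

(** As a [cm] with constant coefficients, [rho] falls under [elemmx_cm] and [dmx_cm]. *)
Let rhoE xi : rho xi = cm (fun i j k => rho (delta_mx 0 i) j k) xi.
Proof.
by apply/esym/(@cm_of_linear R 2 rho) => c u v; rewrite linearP.
Qed.

Let eA : elemmx M A.
Proof.
have e : elemmx M (fun z : 'rV[R]_(2 + 2) =>
    cm (fun i j k => rho (delta_mx 0 i) j k) (rsubmx z)).
  by apply: elemmx_cm; [move=> i j k; exact: elem_cst|exact: elemmx_rsubmx].
by apply: (elemmx_ext e) => z _; rewrite /A rhoE.
Qed.

Let eth : elemmx M (@lsubmx R 1 2 2) := elemmx_lsubmx _.

Let eV : elemmx M (fun z => invmx (A z)) := elemmx_inv eA uA.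

Let emu : elemmx M mu := elemmx_mul eth eV.

Let md r s (B : 'rV[R]_(2 + 2) -> 'M[R]_(r, s)) z : elemmx M B -> M z -> mxdiff B z.
Proof. exact: elemmx_mxdiff. Qed.

(** Here [A] is applied to a tangent vector: [A v] is [rho] of the xi-part of [v], the derivative of
    a linear map. *)
Let dmxA v z : M z -> dmx v A z = A v.
Proof.
move=> Mz; have E : A = fun y => cm (fun i j k => rho (delta_mx 0 i) j k) (rsubmx y).
  by apply/funext => y; rewrite /A rhoE.
rewrite {1}E (dmx_cm v (K := fun _ => _) _ (md (elemmx_rsubmx M) Mz)); last first.
  by move=> i j k; exact: (elem_differentiable oM (elem_cst M _) Mz).
rewrite dmx_rsubmx -rhoE -[RHS]add0r; congr (_ + _).
apply/matrixP => j k; rewrite !mxE big1// => i _.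
by rewrite derive_cst mul0r.
Qed.

Let dmxth v z : M z -> dmx v (@lsubmx R 1 2 2) z = lsubmx v.
Proof.
move=> Mz; apply/matrixP => i j; rewrite (ord1 i) !mxE.
under eq_fun do rewrite mxE.
exact: deriv_coord.
Qed.

Let dmxV v z : M z ->
  dmx v (fun y => invmx (A y)) z = - (invmx (A z) *m A v *m invmx (A z)).
Proof. by move=> Mz; rewrite (dmx_inv oM v eA uA Mz) dmxA. Qed.

(* [res z v] is [rho(xi) dmu(v)]. *)
Let res z v := lsubmx v - mu z *m A v.

Let dmxmu v z : M z -> dmx v mu z = res z v *m invmx (A z).
Proof.
move=> Mz; rewrite (dmx_mul v (md eth Mz) (md eV Mz)) dmxth// dmxV//.
by rewrite /res mulmxBl mulmxN /mu !mulmxA.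
Qed.

Lemma elem_potential : elem M (potential rho).
Proof.
apply: elem_mult; first exact: elem_cst.
apply: elem_plus.
  exact: (elemmx_mul (elemmx_mul eth eV) (elemmx_tr eth) 0 0).
by apply: elem_opp; apply: elem_ln; [exact: elem_det|exact: dA].
Qed.

Let tr_adj v z : M z -> (\det (A z))^-1 * \tr (A v *m \adj (A z)) =
  \tr (invmx (A z) *m A v).
Proof.
move=> Mz; rewrite /invmx uA// -scalemxAl mxtraceZ; congr (_ * _).
exact: mxtrace_mulC.
Qed.

Let tr00 (B : 'M[R]_1) : B^T 0 0 = B 0 0. Proof. by rewrite mxE. Qed.

Let dpot w z := (mu z *m (lsubmx w)^T) 0 0 - 1 / 2 * (mu z *m A w *m (mu z)^T) 0 0
  - 1 / 2 * \tr (invmx (A z) *m A w).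

Lemma deriv_potential w z : M z -> 'D_w (potential rho : _ -> R^o) z = dpot w z.
Proof.
move=> Mz; have eq1 := elemmx_mul (elemmx_mul eth eV) (elemmx_tr eth).
have eq := eq1 0 0; have eD := elem_det eA; have el := elem_ln eD dA.
rewrite (deriv_scale (1 / 2) w (elem_differentiable oM (elem_plus eq (elem_opp el)) Mz)).
rewrite (derivE_plus oM w eq (elem_opp el) Mz).
have -> : 'D_w (fun y => - ln (\det (A y)) : R^o) z = - \tr (invmx (A z) *m A w).
  rewrite deriveN; last first.
    by apply: diff_derivable; exact: (elem_differentiable oM el Mz).
  by rewrite (derivE_ln oM w eD dA Mz) (deriv_det oM w eA Mz) dmxA// tr_adj.
have -> : 'D_w (fun y => (lsubmx y *m invmx (A y) *m (lsubmx y)^T) 0 0 : R^o) z =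
    dmx w (fun y => mu y *m (lsubmx y)^T) z 0 0 by rewrite mxE.
rewrite (dmx_mul w (md emu Mz) (md (elemmx_tr eth) Mz)) dmx_tr dmxth// dmxmu//.
have -> : res z w *m invmx (A z) *m (lsubmx z)^T = res z w *m (mu z)^T.
  by rewrite /mu trmx_mul symV mulmxA.
have E : (lsubmx w *m (mu z)^T) 0 0 = (mu z *m (lsubmx w)^T) 0 0.
  by rewrite -tr00 trmx_mul trmxK.
rewrite mxDE /res mulmxBl mxDE mxNE E /dpot.
by move: (_ 0 0) (_ 0 0) (\tr _) => a b c; field.
Qed.

(** The classical form of the Fisher metric of normal laws: a mean part, dmu rho dmu written through
    [res], plus a covariance part. Using [res] absorbs the cross terms between theta and xi. *)
Lemma deriv2_potential v w z : M z ->
  'D_v (fun y => 'D_w (potential rho : _ -> R^o) y : R^o) z =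
  bil (invmx (A z)) (res z v) (res z w)
  + 1 / 2 * \tr (invmx (A z) *m A v *m (invmx (A z) *m A w)).
Proof.
move=> Mz.
have eB : elemmx M (fun=> A w) by exact: elemmx_cst.
have et : elemmx M (fun=> (lsubmx w)^T) by exact: elemmx_cst.
have e1 := elemmx_mul emu et.
have e2 := elemmx_mul (elemmx_mul emu eB) (elemmx_tr emu).
have e3 := elemmx_mul eV eB.
have e3t : elem M (fun y => \tr (invmx (A y) *m A w)).
  by apply: elem_sum => i; exact: e3.
have e2s := elem_mult (elem_cst M (1 / 2)) (e2 0 0).
have e3s := elem_mult (elem_cst M (1 / 2)) e3t.
have e12 := elem_plus (e1 0 0) (elem_opp e2s).
rewrite (deriv_ext oM v Mz (fun y My => deriv_potential w My)).
have -> : 'D_v (dpot w : _ -> R^o) z = dmx v (fun y => mu y *m (lsubmx w)^T) z 0 0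
    - 1 / 2 * dmx v (fun y => mu y *m A w *m (mu y)^T) z 0 0
    - 1 / 2 * \tr (dmx v (fun y => invmx (A y) *m A w) z).
  have dN f : elem M f -> 'D_v (fun y => - f y : R^o) z = - 'D_v (f : _ -> R^o) z.
    move=> ef; apply: deriveN; apply: diff_derivable.
    exact: (elem_differentiable oM ef Mz).
  rewrite (derivE_plus oM v e12 (elem_opp e3s) Mz).
  rewrite (derivE_plus oM v (e1 0 0) (elem_opp e2s) Mz) (dN _ e2s) (dN _ e3s).
  rewrite (deriv_scale (1 / 2) v (elem_differentiable oM (e2 0 0) Mz)).
  rewrite (deriv_scale (1 / 2) v (elem_differentiable oM e3t Mz)).
  congr (_ - _ * _ - _ * _); rewrite ?mxE//.
  rewrite (deriv_sum oM (F := fun i y => (invmx (A y) *m A w) i i) _ _ _ Mz).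
    by apply: eq_bigr => i _; rewrite mxE.
  by move=> i; exact: e3.
rewrite (dmx_mul v (md emu Mz) (md et Mz)) dmx_cst mulmx0 addr0 dmxmu//.
rewrite (dmx_mul v (md (elemmx_mul emu eB) Mz) (md (elemmx_tr emu) Mz)) dmx_tr.
rewrite (dmx_mul v (md emu Mz) (md eB Mz)) dmx_cst mulmx0 addr0 dmxmu//.
rewrite (dmx_mul v (md eV Mz) (md eB Mz)) dmx_cst mulmx0 addr0 dmxV//.
set r := res z v *m invmx (A z).
have E : (mu z *m A w *m r^T) 0 0 = (r *m A w *m (mu z)^T) 0 0.
  by rewrite -tr00 (trmx_mul (mu z *m A w)) (trmx_mul (mu z)) trmxK symA mulmxA.
have -> : bil (invmx (A z)) (res z v) (res z w) =
    (r *m (lsubmx w)^T) 0 0 - (r *m A w *m (mu z)^T) 0 0.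
  rewrite /bil -/r {1}/res raddfB /= (trmx_mul (mu z)) symA mulmxBr mxDE mxNE.
  by rewrite mulmxA.
have -> : \tr (- (invmx (A z) *m A v *m invmx (A z)) *m A w) =
    - \tr (invmx (A z) *m A v *m (invmx (A z) *m A w)).
  by rewrite mulNmx raddfN /= !mulmxA.
rewrite mxDE E; move: (_ 0 0) (_ 0 0) (\tr _) => a b c.
by field.
Qed.

Let H := hess (m := 3) (potential rho).

Lemma fisher_hess z : M z -> forall v w, fisher rho z v w = bil (H z) v w.
Proof.
move=> Mz v w; rewrite -(bil_hess oM elem_potential v w Mz) /fisher /cov1 cov_cst.
by rewrite (cm_zero (m := 3) z v) mulmx0 /diff1 derive0 subr0.
Qed.

Let bilH z v w : M z -> bil (H z) v w = bil (invmx (A z)) (res z v) (res z w)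
  + 1 / 2 * \tr (invmx (A z) *m A v *m (invmx (A z) *m A w)).
Proof. by move=> Mz; rewrite -(bil_hess oM elem_potential v w Mz) deriv2_potential. Qed.

Let posV z : M z -> forall u, u != 0 -> 0 < bil (invmx (A z)) u u.
Proof.
move=> Mz u u0; have [_ pA] := posA Mz.
have -> : bil (invmx (A z)) u u = bil (A z) (u *m invmx (A z)) (u *m invmx (A z)).
  by rewrite -bil_mul symV mulVmx ?uA// mul1mx.
apply: pA; apply: contraNneq u0 => uV0.
by rewrite -(mulmxKV (uA Mz) u) uV0 mul0mx.
Qed.

Let detV z : M z -> 0 < \det (invmx (A z)).
Proof. by move=> Mz; rewrite det_inv invr_gt0 dA. Qed.

Let posVA z xi : M z -> xi != 0 ->
  0 < \tr (invmx (A z) *m rho xi *m (invmx (A z) *m rho xi)).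
Proof.
move=> Mz xi0; apply: tr_square_gt0; [exact: symV|exact: rho_sym| |exact: detV|].
  rewrite -bil_delta; apply: posV => //.
  by apply/negP => /eqP/matrixP/(_ 0 0); rewrite !mxE /= => /eqP; rewrite oner_eq0.
by apply: contraNneq xi0 => e; apply/eqP/rho_inj; rewrite e linear0.
Qed.

Lemma hess_potential_pos z : M z -> forall v, v != 0 -> 0 < bil (H z) v v.
Proof.
move=> Mz v v0; rewrite bilH//.
have [x0|x0] := eqVneq (rsubmx v) 0.
  have l0 : res z v != 0.
    apply: contraNneq v0; rewrite /res /A x0 linear0 mulmx0 subr0 => l0.
    by rewrite -(hsubmxK v) l0 x0 row_mx0.
  apply: ltr_pwDl; first exact: posV.
  by rewrite /A x0 linear0 !mulmx0 mxtrace0 mulr0.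
apply: ltr_wpDl; last by rewrite mulr_gt0// posVA.
have [->|/(posV Mz)/ltW//] := eqVneq (res z v) 0.
by rewrite /bil !mul0mx mxE.
Qed.

(** By [tr_inv2], the Hessian in xi of [- 1/2 ln (\det (rho xi))]. *)
Let hh z : 'M[R]_2 := \matrix_(i, j) (1 / 2 *
  \tr (invmx (A z) *m rho (delta_mx 0 i) *m (invmx (A z) *m rho (delta_mx 0 j)))).

Let bil_hh z u u' : bil (hh z) u u' =
  1 / 2 * \tr (invmx (A z) *m rho u *m (invmx (A z) *m rho u')).
Proof.
have rE (t : 'rV[R]_2) : rho t = t 0 0 *: rho (delta_mx 0 0) + t 0 1 *: rho (delta_mx 0 1).
  by rewrite {1}(row_sum_delta t) sum_ord2 linearD !linearZ.
rewrite /bil !mul_mx2 ![u'^T _ _]mxE !mxE (rE u) (rE u').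
rewrite !(mulmxDr, mulmxDl) -!(scalemxAr, scalemxAl) !mxtraceD !mxtraceZ.
ring.
Qed.

(** The corner of the unipotent factor, chosen so that this factor sends [v] to the pair of
    [res z v] and [rsubmx v], in which the metric is block diagonal. *)
Let Nm z : 'M[R]_2 := \matrix_(k, l) (- (mu z *m rho (delta_mx 0 k)) 0 l).

Let mulN z u : u *m Nm z = - (mu z *m rho u).
Proof.
apply/rowP => l; rewrite mxE [RHS]mxE {2}(row_sum_delta u) linear_sum mulmx_sumr.
rewrite summxE -sumrN; apply: eq_bigr => k _.
by rewrite linearZ /= -scalemxAr !mxE mulrN.
Qed.

Let hessE z : M z -> H z =
  block_mx 1%:M 0 (Nm z) 1%:M *m block_mx (invmx (A z)) 0 0 (hh z)
  *m (block_mx 1%:M 0 (Nm z) 1%:M)^T.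
Proof.
move=> Mz; set K := block_mx 1%:M 0 _ _.
have E t : t *m K = row_mx (res z t) (rsubmx t).
  rewrite -{1}(hsubmxK t) mul_row_block !mulmx1 mulmx0 add0r mulN.
  by rewrite /res /A.
suff Q (v w : 'rV[R]_(2 + 2)) :
    bil (H z) v w = bil (K *m block_mx (invmx (A z)) 0 0 (hh z) *m K^T) v w.
  by apply: bil_inj; exact: Q.
by rewrite bil_mul bilH// !E bil_block bil_hh.
Qed.

Let det_hessE z : M z -> \det (H z) = \det (invmx (A z)) * \det (hh z).
Proof.
have dK : \det (block_mx 1%:M 0 (Nm z) 1%:M : 'M[R]_(2 + 2)) = 1.
  by rewrite det_lblock !det1 mulr1.
have dD := det_ublock (invmx (A z)) 0 (hh z).
by move=> Mz; rewrite hessE// !det_mulmx det_tr dK dD mulr1 mul1r.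
Qed.

(* Minus one quarter of the Hessian determinant of the quadratic form [\det \o rho]. *)
Let cst_disc := let a := polar_det (rho (delta_mx 0 0)) (rho (delta_mx 0 0)) in
  let b := polar_det (rho (delta_mx 0 1)) (rho (delta_mx 0 1)) in
  let c := polar_det (rho (delta_mx 0 0)) (rho (delta_mx 0 1)) in
  - (a * b - c ^+ 2) / 4.

Let det_hess z : M z -> \det (H z) = cst_disc * (\det (A z))^-1 ^+ 3.
Proof.
move=> Mz; rewrite det_hessE//.
have d0 : \det (A z) != 0 by rewrite gt_eqF ?dA.
have AE : A z = rsubmx z 0 0 *: rho (delta_mx 0 0) + rsubmx z 0 1 *: rho (delta_mx 0 1).
  by rewrite /A {1}(row_sum_delta (rsubmx z)) sum_ord2 linearD !linearZ.
rewrite det_inv det2 !mxE AE det_inv_gram ?rho_sym// -AE//.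
by rewrite /cst_disc; field.
Qed.

(** Positivity is read off the factors [invmx (A z)] and [hh z], both positive definite; through
    [det_hess] it then shows that [cst_disc] is nonzero, by which [tr_dual_position] divides. *)
Lemma det_hess_gt0 z : M z -> 0 < \det (H z).
Proof.
move=> Mz; rewrite det_hessE//.
rewrite mulr_gt0 ?detV// S2_pos_det//; split.
  by apply/matrixP => i j; rewrite !mxE mxtrace_mulC.
move=> u u0; rewrite -[X in 0 < X]/(bil (hh z) u u) bil_hh.
by rewrite mulr_gt0// posVA.
Qed.

Let elemH : elemmx M H := elemmx_hess oM elem_potential.

(** Scaling (theta, xi) leaves mu fixed, so [res z z] vanishes and only the covariance part
    survives, where [invmx (A z) *m A z] is the identity. *)
Let hess_position z v : M z -> bil (H z) z v = 1 / 2 * \tr (invmx (A z) *m A v).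
Proof.
move=> Mz; rewrite bilH// /res /mu mulmxKV ?uA// subrr /bil !mul0mx mxE add0r.
by rewrite mulVmx ?uA// mul1mx.
Qed.

Section Dual.
Variable G : connection R 3.
Hypothesis dualG : dual_connection M (fisher rho) std_flat G.

(** The trace is d log det H = - 3 d log q, and [hess_position] is 1/2 d log q; hence the factor -
    6. *)
Lemma tr_dual_position z v : M z -> \tr (cm (G z) v) = - 6 * bil (H z) z v.
Proof.
move=> Mz; have d0 := dA Mz; have eD := elem_det eA.
have dn0 y : M y -> \det (A y) != 0 by move=> My; rewrite gt_eqF ?dA.
have HD := det_hess_gt0 Mz; have eI := elem_inv eD dn0.
rewrite (cm_dual (m := 3) oM elemH fisher_hess hess_potential_pos dualG v Mz).
have -> : \tr (dmx v H z *m invmx (H z)) =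
    (\det (H z))^-1 * 'D_v (fun y => \det (H y) : R^o) z.
  rewrite (deriv_det oM v elemH Mz) /invmx posdef_unit; last exact: hess_potential_pos.
  by rewrite -scalemxAr mxtraceZ.
rewrite (deriv_ext oM v Mz (fun y My => det_hess My)).
have e3 := elem_mult eI (elem_mult eI eI).
rewrite (deriv_scale cst_disc v (elem_differentiable oM e3 Mz)).
rewrite (derivE_mult oM v eI (elem_mult eI eI) Mz) (derivE_mult oM v eI eI Mz).
rewrite (derivE_inv oM v eD dn0 Mz) (deriv_det oM v eA Mz) dmxA// hess_position//.
rewrite -tr_adj//; move: HD; rewrite det_hess// => HD.
have c0 : cst_disc != 0 by apply: contraTneq HD => ->; rewrite mul0r ltxx.
move: (\det (A z)) (\tr _) d0 => d t d0.
by field; rewrite c0 gt_eqF.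
Qed.

Lemma fisher_hesse_einstein : hesse_einstein M (fisher rho) G.
Proof.
split.
  exact: (dual_hessian_manifold (m := 3) oM elemH fisher_hess
    (hess_sym oM elem_potential) hess_potential_pos
    (fun z Mz u w => hess_codazzi oM elem_potential u w Mz) dualG).
(* 3 = - (1 / 2) * (- 6), the factors coming from [koszul2E] and [tr_dual_position]. *)
exists 3 => z Mz v w.
rewrite (koszul2E (m := 3) oM elemH fisher_hess (hess_sym oM elem_potential) dualG
  (fun y a My => tr_dual_position a My) v w det_hess_gt0 Mz).
by congr (_ * _); field.
Qed.

Lemma fisher_kahler_einstein :
  kahler_einstein (tangent_bundle M) (Tmetric (fisher rho) G) (TJ G).
Proof.
have sH := fun z Mz => hess_sym oM elem_potential (x := z) Mz.
have cod z (Mz : M z) u w := hess_codazzi oM elem_potential u w Mz.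
have eG := elem_dual (m := 3) oM elemH fisher_hess hess_potential_pos dualG.
have dH z v (Mz : M z) := dmx_hess (m := 3) oM elemH fisher_hess dualG v Mz.
have sG z v w (Mz : M z) :=
  dual_sym (m := 3) oM elemH fisher_hess hess_potential_pos cod dualG v w Mz.
have fG z u v (Mz : M z) :=
  dual_flat_eq (m := 3) oM elemH fisher_hess hess_potential_pos dualG u v Mz.
split.
  exact: (tangent_kahler oM elemH fisher_hess sH hess_potential_pos eG dH sG fG).
apply: (tangent_einstein oM elemH fisher_hess sH eG dH sG fG (lam := - 6)).
move=> z u v Mz; exact: (deriv_tr_cm (m := 3) oM elemH fisher_hess sH
  hess_potential_pos dualG (fun y a My => tr_dual_position a My) u v Mz).
Qed.

End Dual.

Lemma fisher_dual_exists : exists Dstar : connection R 3,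
  smooth_connection M Dstar /\ dual_connection M (fisher rho) std_flat Dstar.
Proof.
have d := dual_conn_dual (m := 3) oM elemH fisher_hess hess_potential_pos.
exists (dual_conn (m := 3) H); split => // i j k.
apply: (elem_smooth oM).
exact: (elem_dual (m := 3) oM elemH fisher_hess hess_potential_pos d).
Qed.

End StatisticalModel.

(** The existence clause keeps the clause on all [Dstar] from holding vacuously. *)
Theorem theorem4p8 (R : realType) (U : set 'rV[R]_2)
    (rho : {linear 'rV[R]_2 -> 'M[R]_2}) :
  open U -> connected U -> U !=set0 ->
  injective rho ->
  (forall xi, S2 (rho xi)) ->
  rho @` U `<=` S2_pos ->
  let M := model_domain U in
  let g := fisher rho in
  let D := std_flat in
  (exists Dstar, smooth_connection M Dstar /\ dual_connection M g D Dstar) /\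
  (forall Dstar, smooth_connection M Dstar -> dual_connection M g D Dstar ->
    hesse_einstein M g Dstar /\
    kahler_einstein (tangent_bundle M) (Tmetric g Dstar) (TJ Dstar)).
Proof.
move=> oU _ _ rho_inj rho_sym rho_pos M g D; split.
  exact: (fisher_dual_exists oU rho_inj rho_sym rho_pos).
move=> G _ dualG; split.
  exact: (fisher_hesse_einstein oU rho_inj rho_sym rho_pos dualG).
exact: (fisher_kahler_einstein oU rho_inj rho_sym rho_pos dualG).
Qed.
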